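(* Let $\Lambda_0=\{\tau\in\mathbb C:|\tau|>40\}$, $f_\tau(z)=\frac{\tau}{2}(z^2-1)+1$ for $\tau\in\Lambda_0$, and let $\Lambda$ be the interior in $l^\infty(\mathbb C)$ (sup-norm topology) of the set of bounded sequences in $\Lambda_0^{\mathbb N}$. Then there exists an open and dense set $\Omega\subset\Lambda$ (for the $l^\infty$-topology) such that $\mathrm{HD}(\mathcal J_\lambda)<\mathrm{PD}(\mathcal J_\lambda)$ for every $\lambda\in\Omega$.
   Context: For $\lambda=(\lambda_1,\lambda_2,\dots)\in\Lambda_0^{\mathbb N}$ let $f_\lambda^n:=f_{\lambda_n}\circ\dots\circ f_{\lambda_1}$. The Fatou set is the set of $z$ in the Riemann sphere $\hat{\mathbb C}$ near which $(f_\lambda^n)_n$ is a normal family, and the Julia set $\mathcal J_\lambda$ is its complement in $\hat{\mathbb C}$. $\mathrm{HD}$ and $\mathrm{PD}$ denote Hausdorff and packing dimension (with respect to the spherical metric). *)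

(* Defs.v *)
From HB Require Import structures.
From mathcomp Require Import all_boot all_order all_algebra complex.
From mathcomp Require Import all_classical all_reals all_analysis.
From mathcomp Require Import ring lra.

Set Implicit Arguments.
Unset Strict Implicit.
Unset Printing Implicit Defensive.

Import Order.TTheory GRing.Theory Num.Theory.
Import Normc.

Local Open Scope classical_set_scope.
Local Open Scope ring_scope.

(* [normc : R[i] -> R] is the real-valued modulus of Normc; the norm `|z| of
   the numFieldType R[i] lives in R[i] itself. *)

Section DimensionsDef.
Context {R : realType} {T : metricType R}.
Implicit Types (A : set T) (s d : R).

Local Open Scope ereal_scope.

(* The maximum with 0 gives diam set0 = 0 instead of -oo. *)
Definition diam A : \bar R :=
  maxe 0 (ereal_sup [set (mdist p.1 p.2)%:E | p in A `*` A]).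

Definition hausdorff_content s d A : \bar R :=
  ereal_inf [set \sum_(0 <= i <oo) poweR (diam (U i)) s | U in
    [set U : nat -> set T |
      (forall i, diam (U i) <= d%:E) /\ A `<=` \bigcup_i U i]].

(* Nonincreasing in d, so the limit as d -> 0+ is a supremum. *)
Definition hausdorff_measure s A : \bar R :=
  ereal_sup [set hausdorff_content s d A | d in [set d | (0 < d)%R]].

Definition hausdorff_dim A : \bar R :=
  ereal_inf [set s%:E | s in [set s | (0 < s)%R /\ hausdorff_measure s A = 0]].

Definition mdist_cball (x : T) (r : R) : set T :=
  [set y | (mdist x y <= r)%R].

(* A packing of A: a countable (possibly finite) family, indexed by I, of
   pairwise disjoint closed balls of radii at most d centred in A. *)
Definition packing A d (I : set nat) (c : nat -> T) (r : nat -> R) : Prop :=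
  (forall i, I i -> A (c i) /\ (0 < r i <= d)%R) /\
  trivIset I (fun i => mdist_cball (c i) (r i)).

Definition packing_content s d A : \bar R :=
  ereal_sup [set x : \bar R | exists I c r, packing A d I c r /\
    x = esum I (fun i => ((2 * r i) `^ s)%:E)].

(* Nondecreasing in d, so the limit as d -> 0+ is an infimum. *)
Definition packing_premeasure s A : \bar R :=
  ereal_inf [set packing_content s d A | d in [set d | (0 < d)%R]].

Definition packing_measure s A : \bar R :=
  ereal_inf [set \sum_(0 <= i <oo) packing_premeasure s (U i) | U in
    [set U : nat -> set T | A `<=` \bigcup_i U i]].

Definition packing_dim A : \bar R :=
  ereal_inf [set s%:E | s in [set s | (0 < s)%R /\ packing_measure s A = 0]].

End DimensionsDef.

(* The Riemann sphere, with [None] as the point at infinity. *)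
Definition sphere (R : realType) := option R[i].

HB.instance Definition _ (R : realType) :=
  Choice.on (sphere R).

Section SphericalMetric.
Context {R : realType}.
Implicit Types (p q : sphere R) (u v w : R * R * R).

(* Inverse stereographic projection onto the unit sphere of R^3. *)
Definition stereo p : R * R * R :=
  if p is Some z then
    (2 * complex.Re z / (1 + normc z ^+ 2), 2 * complex.Im z / (1 + normc z ^+ 2),
     (normc z ^+ 2 - 1) / (1 + normc z ^+ 2))
  else (0, 0, 1).

Definition dot3 u v : R := u.1.1 * v.1.1 + u.1.2 * v.1.2 + u.2 * v.2.

(* The great-circle distance, i.e. the length metric of 2|dz| / (1 + |z|^2). *)
Definition sph_dist p q : R := acos (dot3 (stereo p) (stereo q)).

Let sqr_normc (z : R[i]) : normc z ^+ 2 = complex.Re z ^+ 2 + complex.Im z ^+ 2.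
Proof. by case: z => a b /=; rewrite sqr_sqrtr // addr_ge0 ?sqr_ge0. Qed.

Let den_gt0 (z : R[i]) : 0 < 1 + (complex.Re z ^+ 2 + complex.Im z ^+ 2).
Proof. by rewrite ltr_wpDr ?addr_ge0 ?sqr_ge0. Qed.

Lemma stereo_unit p : dot3 (stereo p) (stereo p) = 1.
Proof.
case: p => [z|]; rewrite /dot3 /=; last by ring.
rewrite sqr_normc; have := den_gt0 z; set a := complex.Re z; set b := complex.Im z => d0.
by field; rewrite gt_eqF.
Qed.

Lemma stereo_inj : injective stereo.
Proof.
have lt1 z : (stereo (Some z)).2 < 1.
  rewrite /= sqr_normc ltr_pdivrMr ?den_gt0 // mul1r addrC ltrD2r.
  exact: lt_trans (ltrN10 _) ltr01.
move=> [z|] [w|] // e; last 2 first.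
- by have := lt1 z; rewrite e /= ltxx.
- by have := lt1 w; rewrite -e /= ltxx.
move: e => /= -[]; rewrite !sqr_normc.
have := den_gt0 z; have := den_gt0 w.
case: z => a b; case: w => c d /=.
set m := 1 + (c ^+ 2 + d ^+ 2); set n := 1 + (a ^+ 2 + b ^+ 2) => m0 n0 e1 e2 e3.
have mn : m = n.
  have h (x k : R) : 0 < k -> x = k - 2 -> x / k = 1 - 2 * k^-1.
    by move=> k0 ->; field; rewrite gt_eqF.
  have f3 := h (a ^+ 2 + b ^+ 2 - 1) n n0 ltac:(rewrite /n; ring).
  have g3 := h (c ^+ 2 + d ^+ 2 - 1) m m0 ltac:(rewrite /m; ring).
  apply: invr_inj; move: e3; rewrite f3 g3.
  by clearbody m n; move: m^-1 n^-1 => x y e; lra.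
move: e1 e2; rewrite mn => /(mulIf _) e1 /(mulIf _) e2.
have nn : n^-1 != 0 by rewrite invr_eq0 gt_eqF.
have ea : a = c by apply: (@mulfI _ 2); rewrite ?pnatr_eq0 ?e1.
have eb : b = d by apply: (@mulfI _ 2); rewrite ?pnatr_eq0 ?e2.
by rewrite ea eb.
Qed.

Let dot3C u v : dot3 u v = dot3 v u.
Proof. by rewrite /dot3; ring. Qed.

Let dot3_bound u v : dot3 u u = 1 -> dot3 v v = 1 -> -1 <= dot3 u v <= 1.
Proof.
case: u => -[a b] c; case: v => -[x y] z; rewrite /dot3 /= => hu hv.
have h1 := sqr_ge0 (a - x); have h2 := sqr_ge0 (b - y).
have h3 := sqr_ge0 (c - z); have h4 := sqr_ge0 (a + x).
have h5 := sqr_ge0 (b + y); have h6 := sqr_ge0 (c + z).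
by apply/andP; split; lra.
Qed.

Let dot3_eq1 u v : dot3 u u = 1 -> dot3 v v = 1 -> dot3 u v = 1 -> u = v.
Proof.
case: u => -[a b] c; case: v => -[x y] z; rewrite /dot3 /= => hu hv huv.
have h1 := sqr_ge0 (a - x); have h2 := sqr_ge0 (b - y).
have h3 := sqr_ge0 (c - z).
have k1 : (a - x) ^+ 2 = 0 by lra.
have k2 : (b - y) ^+ 2 = 0 by lra.
have k3 : (c - z) ^+ 2 = 0 by lra.
move/eqP: k1; move/eqP: k2; move/eqP: k3.
by rewrite !sqrf_eq0 !subr_eq0 => /eqP -> /eqP -> /eqP ->.
Qed.

(* Nonnegativity of the Gram determinant, which is a squared determinant. *)
Let gram u v w : dot3 u u = 1 -> dot3 v v = 1 -> dot3 w w = 1 ->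
  (dot3 u v * dot3 v w - dot3 u w) ^+ 2
    <= (1 - dot3 u v ^+ 2) * (1 - dot3 v w ^+ 2).
Proof.
move=> hu hv hw; rewrite -subr_ge0.
suff -> : (1 - dot3 u v ^+ 2) * (1 - dot3 v w ^+ 2)
          - (dot3 u v * dot3 v w - dot3 u w) ^+ 2 =
    (u.1.1 * (v.1.2 * w.2 - v.2 * w.1.2)
     - u.1.2 * (v.1.1 * w.2 - v.2 * w.1.1)
     + u.2 * (v.1.1 * w.1.2 - v.1.2 * w.1.1)) ^+ 2 by exact: sqr_ge0.
transitivity (dot3 u u * dot3 v v * dot3 w w
  + 2 * dot3 u v * dot3 v w * dot3 u w - dot3 u u * dot3 v w ^+ 2
  - dot3 v v * dot3 u w ^+ 2 - dot3 w w * dot3 u v ^+ 2).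
  by rewrite hu hv hw; ring.
by rewrite /dot3; ring.
Qed.

Lemma sph_distxx p : sph_dist p p = 0.
Proof. by rewrite /sph_dist stereo_unit acos1. Qed.

Lemma sph_dist_eq0 p q : sph_dist p q = 0 -> p = q.
Proof.
move=> e; apply/stereo_inj/dot3_eq1; rewrite ?stereo_unit //.
have := dot3_bound (stereo_unit p) (stereo_unit q) => b.
by rewrite -[LHS]acosK ?in_itv // -/(sph_dist p q) e cos0.
Qed.

Lemma sph_distC p q : sph_dist p q = sph_dist q p.
Proof. by rewrite /sph_dist dot3C. Qed.

Lemma sph_dist_triangle q p s : sph_dist p s <= sph_dist p q + sph_dist q s.
Proof.
have := dot3_bound (stereo_unit p) (stereo_unit q).
have := dot3_bound (stereo_unit q) (stereo_unit s).
have := dot3_bound (stereo_unit p) (stereo_unit s).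
have := gram (stereo_unit p) (stereo_unit q) (stereo_unit s).
rewrite /sph_dist; set a := dot3 _ _; set b := dot3 _ _; set c := dot3 _ _.
move=> hg hc hb ha.
have [h|h] := leP (pi : R) (acos a + acos b).
  exact: le_trans (acos_lepi hc) h.
rewrite leNgt; apply/negP => hlt.
have hab : (acos a + acos b) \in `[0, pi].
  by rewrite in_itv /= addr_ge0 ?acos_ge0 //= ltW.
have hcc : acos c \in `[0, pi] by rewrite in_itv /= acos_ge0 ?acos_lepi.
move: hlt; rewrite -(ltr_cos hab hcc) cosD !acosK ?in_itv // !sin_acos //.
apply/negP; rewrite -leNgt lerBlDr -lerBlDl -sqrtrM; last first.
  by rewrite subr_ge0; nra.
by rewrite (le_trans (ler_norm _)) // -sqrtr_sqr ler_wsqrtr.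
Qed.

HB.instance Definition _ := @isMetric.Build R (sphere R) sph_dist
  sph_distxx sph_dist_eq0 sph_distC sph_dist_triangle.

End SphericalMetric.

(* l^oo(C). *)
Record linf (R : realType) := Linf {
  linf_seq :> nat -> R[i];
  linf_bounded : exists M : R, forall n, normc (linf_seq n) <= M }.

HB.instance Definition _ (R : realType) := gen_eqMixin (linf R).
HB.instance Definition _ (R : realType) := gen_choiceMixin (linf R).

Section LinfMetric.
Context {R : realType}.
Implicit Types x y z : linf R.

Definition linf_dist x y : R := sup (range (fun n => normc (x n - y n))).

Let normcB (a b : R[i]) : normc (a - b) = normc (b - a).
Proof. by rewrite -normcN opprB. Qed.

Let linf_has_sup x y : has_sup (range (fun n => normc (x n - y n))).
Proof.
split; first by exists (normc (x 0%N - y 0%N)), 0%N.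
have [M hM] := linf_bounded x; have [N hN] := linf_bounded y.
exists (M + N) => _ [n _ <-].
by rewrite (le_trans (le_normcD _ _)) // normcN lerD.
Qed.

Lemma linf_dist_ub x y n : normc (x n - y n) <= linf_dist x y.
Proof. by apply: ub_le_sup; [case: (linf_has_sup x y)|exists n]. Qed.

Lemma linf_dist_le x y (e : R) :
  (forall n, normc (x n - y n) <= e) -> linf_dist x y <= e.
Proof.
move=> h; apply: ge_sup; first by case: (linf_has_sup x y).
by move=> _ [n _ <-].
Qed.

Lemma linf_distxx x : linf_dist x x = 0.
Proof.
apply/eqP; rewrite eq_le; apply/andP; split.
  by apply: linf_dist_le => n; rewrite subrr normc0.
by apply: le_trans (linf_dist_ub x x 0%N); rewrite subrr normc0.
Qed.

Lemma linf_dist_eq0 x y : linf_dist x y = 0 -> x = y.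
Proof.
move=> e; have xy : linf_seq x = linf_seq y.
  apply/funext => n; apply/eqP; rewrite -subr_eq0; apply/eqP/eq0_normc.
  apply/eqP; rewrite eq_le -{1}e linf_dist_ub /=.
  by case: (_ - _) => a b /=; rewrite sqrtr_ge0.
case: x y xy {e} => [x hx] [y hy] /= xy; subst y.
by rewrite (Prop_irrelevance hx hy).
Qed.

Lemma linf_distC x y : linf_dist x y = linf_dist y x.
Proof.
by apply/eqP; rewrite eq_le; apply/andP; split;
   apply: linf_dist_le => n; rewrite normcB linf_dist_ub.
Qed.

Lemma linf_dist_triangle y x z :
  linf_dist x z <= linf_dist x y + linf_dist y z.
Proof.
apply: linf_dist_le => n; rewrite -(subrKA (y n)).
by rewrite (le_trans (le_normcD _ _)) // lerD // linf_dist_ub.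
Qed.

HB.instance Definition _ := @isMetric.Build R (linf R) linf_dist
  linf_distxx linf_dist_eq0 linf_distC linf_dist_triangle.

End LinfMetric.

Section Dynamics.
Context {R : realType}.

Definition Lambda0 : set R[i] := [set t | 40 < normc t].

Definition quad (t z : R[i]) : R[i] := t / 2 * (z ^+ 2 - 1) + 1.

(* The extension to the sphere fixes infinity. *)
Definition fsph (t : R[i]) : sphere R -> sphere R := omap (quad t).

(* Sequences are indexed from 0: [l n] is lambda_(n+1), and
   [compn l n] is f_(lambda_n) o ... o f_(lambda_1). *)
Fixpoint compn (l : nat -> R[i]) (n : nat) : sphere R -> sphere R :=
  if n is m.+1 then fsph (l m) \o compn l m else id.

(* Convergence is uniform, for the spherical metric, on compact subsets of U;
   the values of the limit g outside U are irrelevant. *)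
Definition normal_family (U : set (sphere R))
    (F : set (sphere R -> sphere R)) : Prop :=
  forall u : nat -> sphere R -> sphere R, (forall k, F (u k)) ->
  exists phi : nat -> nat, {homo phi : m n / (m < n)%N} /\
  exists g : sphere R -> sphere R,
    {family (fun K => compact K /\ K `<=` U), (u \o phi) @ \oo --> g}.

Definition fatou_set (l : nat -> R[i]) : set (sphere R) :=
  [set z | exists2 U, open_nbhs z U &
    normal_family U (range (fun n => compn l n.+1))].

Definition julia_set (l : nat -> R[i]) : set (sphere R) := ~` fatou_set l.

Definition Lambda : set (linf R) :=
  interior [set l : linf R | forall n, Lambda0 (l n)].

End Dynamics.

(* Main.v *)
Require Import Defs.
From mathcomp Require Import all_boot all_order all_algebra complex.
From mathcomp Require Import all_classical all_reals all_analysis.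
From mathcomp Require Import ring lra zify.

(* Since |l_i| > 40, every orbit that stays near the origin stays in the two
   discs of radius 1/10 around the points 1 and -1, both of which f_t maps to 1.
   The Julia set is therefore a Cantor set coded by words of signs, the word w
   of length n contributing a piece of diameter comparable to exp(- ell w),
   where ell w = log |(f^n)'(x_w)| and x_w is the point of that piece with
   f^n(x_w) = 1.  With Z_n(t) = sum over |w| = n of exp(- t * ell w), covering
   by the pieces gives HD <= t as soon as liminf Z_n(t) = 0, and a Baire argument
   on words gives PD >= t as soon as limsup Z_n(t) = oo.
   Let h be the infimum of the t with Z_n(t) <= 1 infinitely often.  Multiply
   l_i by 1 + e for i in a set S made of alternate, longer and longer, blocks.
   The points x_w move so little that ell w grows by an amount comparable to e
   times the number of i < n in S, uniformly in w.  At the ends of the blocks of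
   S this makes Z_n(t) exponentially small for some t < h, while at the ends of
   the other blocks ell w has hardly changed and Z_n(t) is exponentially large
   for t slightly below h.  The block lengths and the distances to h can be
   chosen so that the first t is smaller than the second, and both facts are stable
   under perturbations of l that are small in sup-norm. *)

Import Order.TTheory GRing.Theory Num.Theory.
Import Normc.
Import numFieldNormedType.Exports.

Set Implicit Arguments.
Unset Strict Implicit.
Unset Printing Implicit Defensive.

Local Open Scope classical_set_scope.
Local Open Scope ring_scope.

(** * The two inverse branches *)

Section ComplexModulus.
Context {R : realType}.
Implicit Types (x y z : R[i]) (r : R).

Lemma normc_ge0 z : 0 <= normc z.
Proof. by case: z => a b; exact: sqrtr_ge0. Qed.

Lemma normc_gt0 z : (0 < normc z) = (z != 0).
Proof.
rewrite lt_neqAle normc_ge0 andbT eq_sym; congr negb.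
by apply/eqP/eqP => [/eq0_normc|->] //; rewrite normc0.
Qed.

Lemma normcBC x y : normc (x - y) = normc (y - x).
Proof. by rewrite -normcN opprB. Qed.

Lemma normc_triangle y x z : normc (x - z) <= normc (x - y) + normc (y - z).
Proof. by rewrite (le_trans _ (le_normcD _ _)) // subrKA. Qed.

Lemma le_normcB x y : normc x - normc y <= normc (x - y).
Proof. by rewrite lerBlDr (le_trans _ (le_normcD _ _)) // subrK. Qed.

Lemma normc_nat n : normc (n%:R : R[i]) = n%:R.
Proof. by rewrite normcMn normc1. Qed.

Lemma normc_sqr z : normc (z ^+ 2) = normc z ^+ 2.
Proof. by rewrite !expr2 normcM. Qed.

Lemma normc_div x y : normc (x / y) = normc x / normc y.
Proof. by rewrite normcM normcV. Qed.

Lemma normc_real r : 0 <= r -> normc (r%:C)%C = r.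
Proof. by move=> r0; rewrite /normc /= expr0n addr0 sqrtr_sqr ger0_norm. Qed.

Lemma ge_Re_normc z : `|complex.Re z| <= normc z.
Proof.
case: z => a b /=; rewrite -sqrtr_sqr ler_wsqrtr // lerDl sqr_ge0 //.
Qed.

Lemma ge_Im_normc z : `|complex.Im z| <= normc z.
Proof.
case: z => a b /=; rewrite -sqrtr_sqr ler_wsqrtr // lerDr sqr_ge0 //.
Qed.

Lemma normc_le_ReIm z : normc z <= `|complex.Re z| + `|complex.Im z|.
Proof.
case: z => a b /=; rewrite -[leRHS]ger0_norm ?addr_ge0 // -sqrtr_sqr ler_wsqrtr //.
rewrite sqrrD !real_normK ?num_real // -addrA lerD2l lerDr.
by rewrite mulrn_wge0 // mulr_ge0.
Qed.

Lemma Re_sqrtc_ge0 z : 0 <= complex.Re (sqrtc z).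
Proof. by case: z => a b; exact: sqrtr_ge0. Qed.

End ComplexModulus.

Section Branches.
Context {R : realType}.
Implicit Types (t y z : R[i]) (b : bool).

Definition sg b : R[i] := if b then 1 else -1.

(* Both discs inB lie in inV, and they contain the preimage of inV under f_t. *)
Definition inV z := normc (z - 1) <= 21/10.
Definition inB b z := normc (z - sg b) <= 1/10.

Lemma sg_sqr b : sg b * sg b = 1.
Proof. by case: b; rewrite /sg ?mulrNN mulr1. Qed.

Lemma normc_sg b : normc (sg b) = 1.
Proof. by case: b; rewrite /sg ?normcN normc1. Qed.

Lemma sg_inB b : inB b (sg b).
Proof. by rewrite /inB subrr normc0 divr_ge0. Qed.

Lemma normc_sg_sub b : normc (sg b - 1) <= 2.
Proof.
by rewrite (le_trans (le_normcD _ _)) // normc_sg normcN normc1.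
Qed.

Lemma inB_inV b z : inB b z -> inV z.
Proof.
rewrite /inB /inV => h; have := normc_triangle (sg b) z 1; have := normc_sg_sub b.
lra.
Qed.

Lemma sg_inV b : inV (sg b). Proof. exact/inB_inV/sg_inB. Qed.

Lemma inB_norm b z : inB b z -> 9/10 <= normc z <= 11/10.
Proof.
rewrite /inB => h; have := le_normcB z (sg b); have := le_normcB (sg b) z.
by rewrite (normcBC (sg b)) normc_sg => h1 h2; lra.
Qed.

Lemma normcD_inB b z z' : inB b z -> inB b z' -> 9/5 <= normc (z + z').
Proof.
rewrite /inB => h h'.
have h3 : normc (sg b + sg b) = 2.
  by rewrite -mulr2n normcMn normc_sg.
have := le_normcB (sg b + sg b) ((sg b + sg b) - (z + z')).
rewrite subKr h3.
have -> : sg b + sg b - (z + z') = (sg b - z) + (sg b - z') by ring.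
by have := le_normcD (sg b - z) (sg b - z'); rewrite !(normcBC (sg b)); lra.
Qed.

Lemma inB_far b z z' : inB b z -> inB (~~ b) z' -> 9/5 <= normc (z - z').
Proof.
move=> h h'; rewrite -[- z']/(- z'); apply: (normcD_inB h); move: h'.
by rewrite /inB; case: b {h} => /=; rewrite -normcN opprD opprK // opprK.
Qed.

Lemma quadB t z z' : quad t z - quad t z' = t / 2 * (z - z') * (z + z').
Proof. by rewrite /quad; ring. Qed.

Lemma normc_quadB t z z' :
  normc (quad t z - quad t z') = normc t / 2 * normc (z - z') * normc (z + z').
Proof. by rewrite quadB !normcM normcV normc_nat. Qed.

Lemma quad_sub1 t z : t != 0 -> z ^+ 2 - 1 = 2 * (quad t z - 1) / t.
Proof. by move=> t0; rewrite /quad; field. Qed.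

(* |z^2 - 1| <= 2 * (21/10) / 40 as |quad t z - 1| <= 21/10 and 40 < |t|. *)
Lemma quad_inV t z : 40 < normc t -> inV (quad t z) ->
  normc (z - 1) * normc (z + 1) <= 21/200.
Proof.
move=> ht; rewrite /inV => h; rewrite -normcM.
have t0 : t != 0 by rewrite -normc_gt0; lra.
have -> : (z - 1) * (z + 1) = z ^+ 2 - 1 by ring.
rewrite (quad_sub1 z t0) normc_div normcM normc_nat ler_pdivrMr; lra.
Qed.

(** The product [|z - 1| |z + 1|] is at most 21/200 while the sum of the factors is at least 2, so
    one factor is small. The sign of [Re z] forces the other to be at least 1 and so decides
    which. *)
Lemma quad_inV_inB t z : 40 < normc t -> inV (quad t z) ->
  inB (0 <= complex.Re z) z.
Proof.
move=> ht hq; have := quad_inV ht hq; rewrite /inB.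
(* Bootstrap: [1 <= b] gives [a <= 21/200], and then [b >= 2 - a] sharpens this to [a <= 1/10]. *)
have arith (a b : R) : 0 <= a -> 1 <= b -> 2 <= a + b -> a * b <= 21/200 -> a <= 1/10.
  move=> a0 b1 ab h; have ha : a <= 21/200 by nra.
  by have : a * (2 - a) <= 21/200; nra.
have h2 : 2 <= normc (z - 1) + normc (z + 1).
  have := normc_triangle z 1 (-1); rewrite !opprK (normcBC 1).
  by have -> : normc (1 + 1 : R[i]) = 2 by exact: (normc_nat 2).
have := ge_Re_normc (z - 1); have := ge_Re_normc (z + 1).
have [rz|rz] := leP 0 (complex.Re z); rewrite /sg.
- have -> : complex.Re (z + 1) = complex.Re z + 1 by case: z {hq rz h2}.
  move=> h1 _; apply: arith (normc_ge0 _) _ h2.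
  by apply: le_trans h1; rewrite ger0_norm; lra.
- have -> : complex.Re (z - 1) = complex.Re z - 1 by case: z {hq rz h2}.
  rewrite opprK mulrC addrC in h2 *; move=> _ h1; apply: arith (normc_ge0 _) _ h2.
  by apply: le_trans h1; rewrite ler0_norm; lra.
Qed.

End Branches.

(** * Orbits and cylinders *)

Section Orbits.
Context {R : realType}.
Implicit Types (l : nat -> R[i]) (z p : R[i]) (b : bool) (w : seq bool) (n : nat).

Definition shift l : nat -> R[i] := fun n => l n.+1.

Fixpoint orb l n z : R[i] := if n is m.+1 then quad (l m) (orb l m z) else z.

Lemma compn_Some l n z : compn l n (Some z) = Some (orb l n z).
Proof. by elim: n => //= n ->. Qed.

Lemma compn_None l n : compn l n None = None.
Proof. by elim: n => //= n ->. Qed.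

Lemma orbS l n z : orb l n.+1 z = orb (shift l) n (quad (l 0) z).
Proof. by elim: n => //= n ->. Qed.

Definition expanding l := forall n, 40 < normc (l n).

Lemma expanding_shift l : expanding l -> expanding (shift l).
Proof. by move=> h n; exact: h. Qed.

Lemma expanding_neq0 l n : expanding l -> l n != 0.
Proof. by move=> /(_ n) h; rewrite -normc_gt0; lra. Qed.

(* The letters of w are the signs of the first iterates; the point reached after
   the last letter is only required to lie in inV. *)
Fixpoint cyl l w z : Prop :=
  if w is b :: w' then inB b z /\ cyl (shift l) w' (quad (l 0) z) else inV z.

Lemma cyl_inV l w z : cyl l w z -> inV z.
Proof. by case: w => //= b w [/inB_inV]. Qed.

Lemma cyl_inV_orb l w z : cyl l w z -> inV (orb l (size w) z).
Proof.
by elim: w l z => //= b w ih l z [_ /ih]; rewrite -[quad (l (size w)) _]/(orb l (size w).+1 z) orbS.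
Qed.

Lemma cyl_cat l u v z : cyl l (u ++ v) z -> cyl l u z.
Proof. by elim: u l z => /= [l z /cyl_inV //|b u ih l z [? /ih]]. Qed.

Fixpoint log_orb l n z : R :=
  if n is m.+1 then ln (normc z) + log_orb (shift l) m (quad (l 0) z) else 0.

Definition log_par l n : R := \sum_(i < n) ln (normc (l i)).

(* The logarithm of |(f_l^n)'(z)|, as f_t'(z) = t z. *)
Definition log_der l n z : R := log_par l n + log_orb l n z.

Definition par_dist l l' n : R := \sum_(i < n) normc (1 - l i / l' i).

Lemma log_derS l n z :
  log_der l n.+1 z = ln (normc (l 0)) + ln (normc z) + log_der (shift l) n (quad (l 0) z).
Proof. by rewrite /log_der /= /log_par big_ord_recl /=; lra. Qed.

Lemma ln_lipschitz (m a b : R) : 0 < m -> m <= a -> m <= b ->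
  `|ln a - ln b| <= `|a - b| / m.
Proof.
move=> m0; have half x y : m <= x -> m <= y -> ln x - ln y <= `|x - y| / m.
  move=> mx my; have y0 := lt_le_trans m0 my; have x0 := lt_le_trans m0 mx.
  rewrite -ln_div ?posrE //; apply: (@le_trans _ _ ((x - y) / y)).
    rewrite mulrBl divff ?gt_eqF // -[x / y in leLHS](subrKC 1).
    by apply: le_ln1Dx; rewrite -subr_gt0 opprK subrK divr_gt0.
  apply: (@le_trans _ _ (`|x - y| / y)).
    by rewrite ler_pM2r ?invr_gt0 // ler_norm.
  by rewrite ler_wpM2l // lef_pV2.
by move=> ma mb; rewrite ler_norml lerNl opprB half // distrC half.
Qed.

Lemma ln_inB b z z' : inB b z -> inB b z' ->
  `|ln (normc z) - ln (normc z')| <= normc (z - z') * (10 / 9).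
Proof.
move=> /inB_norm/andP[h _] /inB_norm/andP[h' _].
apply: (le_trans (@ln_lipschitz (9/10) _ _ _ h h')); first by [].
rewrite invf_div ler_wpM2r //.
have := le_normcB z z'; have := le_normcB z' z; rewrite (normcBC z') ler_norml; lra.
Qed.

(** Writing [z ^+ 2 - z' ^+ 2] through the two images shows that a change of parameter enters only
    by its relative size [1 - t / t']. The constant 36 is half of 40 times 9/5. *)
Lemma two_orbits_step b (t t' z z' : R[i]) : 40 < normc t -> 40 < normc t' ->
  inB b z -> inB b z' -> inV (quad t' z') ->
  36 * normc (z - z')
    <= normc (quad t z - quad t' z') + 21 / 10 * normc (1 - t / t').
Proof.
move=> ht ht' hz hz' hV.
have t0 : t != 0 by rewrite -normc_gt0; lra.
have t0' : t' != 0 by rewrite -normc_gt0; lra.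
have e : (z - z') * (z + z') =
    2 * ((quad t z - quad t' z') + (quad t' z' - 1) * (1 - t / t')) / t.
  by rewrite /quad; field; rewrite t0.
have := congr1 (@normc R) e; rewrite normc_div !normcM normc_nat.
have := le_normcD (quad t z - quad t' z') ((quad t' z' - 1) * (1 - t / t')).
rewrite normcM.
have := normcD_inB hz hz'; have := normc_ge0 (z - z'); have := normc_ge0 (1 - t / t').
move: hV; rewrite /inV.
move: (normc (z - z')) (normc (z + z')) (normc (1 - t / t')) (normc (quad t z - _)).
move: (normc (quad t' z' - 1)) (normc (_ + _)).
move=> v s e0 a Q e1 hv Q0 e00 ha hs /(congr1 ( *%R^~ (normc t))).
rewrite divfK; last by rewrite gt_eqF //; lra.
move=> h; have : e0 * (9 / 5) * 40 <= e0 * a * normc t.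
  by rewrite ler_pM ?mulr_ge0 ?ler_wpM2l //; lra.
have := ler_wpM2r Q0 hv.
lra.
Qed.

(** Distances shrink by 36 at each backward step, so the errors add up like a geometric series. The
    summand [normc (z - z') / 10] on the left is the slack that closes the induction. With [l = l']
    this is bounded distortion; with equal end points it measures the dependence on the
    parameters. *)
Lemma log_orb_compare l l' w z z' : expanding l -> expanding l' ->
  cyl l w z -> cyl l' w z' ->
  `|log_orb l (size w) z - log_orb l' (size w) z'| + normc (z - z') / 10
  <= (normc (orb l (size w) z - orb l' (size w) z') + par_dist l l' (size w)) / 10.
Proof.
elim: w l l' z z' => [|b w ih] l l' z z' hl hl' /=.
  by rewrite /par_dist big_ord0 subrr normr0 add0r addr0.
move=> [hz cz] [hz' cz'].
have := ih _ _ _ _ (expanding_shift hl) (expanding_shift hl') cz cz'.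
rewrite -!orbS /=.
have -> : par_dist l l' (size w).+1 =
    normc (1 - l 0%N / l' 0%N) + par_dist (shift l) (shift l') (size w).
  by rewrite /par_dist big_ord_recl.
have := ln_inB hz hz'.
have := two_orbits_step (hl 0%N) (hl' 0%N) hz hz' (cyl_inV cz').
have := normc_ge0 (1 - l 0%N / l' 0%N); have := normc_ge0 (quad (l 0%N) z - quad (l' 0%N) z').
set A := log_orb _ _ _; set B := log_orb _ _ _.
have := ler_normD (ln (normc z) - ln (normc z')) (A - B).
have -> : ln (normc z) - ln (normc z') + (A - B) = ln (normc z) + A - (ln (normc z') + B).
  by ring.
lra.
Qed.

End Orbits.

(** * Bounded distortion, diameter and separation of cylinders *)

Section Distortion.
Context {R : realType}.
Implicit Types (l : nat -> R[i]) (z p : R[i]) (b : bool) (w : seq bool) (n : nat).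

Lemma inV_dist z z' : inV z -> inV z' -> normc (z - z') <= 21 / 5.
Proof.
rewrite /inV => h h'; have := normc_triangle 1 z z'; rewrite (normcBC 1); lra.
Qed.

Lemma expR1_le4 : expR 1 <= 4 :> R.
Proof.
have h : expR (1 / 2) <= 2 :> R.
  rewrite -[leLHS]invrK -expRN invf_ple ?posrE ?expR_gt0 //.
  by rewrite (le_trans _ (expR_ge1Dx _)) //; lra.
rewrite (_ : 1 = 1 / 2 + 1 / 2); last by lra.
by rewrite expRD (le_trans (ler_pM _ _ h h)) ?expR_ge0 //; lra.
Qed.

Lemma log_step_ge1 b (t z : R[i]) : 40 < normc t -> inB b z ->
  1 <= ln (normc t) + ln (normc z).
Proof.
move=> ht /inB_norm/andP[hz _].
rewrite -lnM ?posrE; [|lra|lra].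
rewrite -ler_expR lnK ?posrE; last by rewrite mulr_gt0 //; lra.
apply: (le_trans expR1_le4).
have : 40 * (9 / 10) <= normc t * normc z by rewrite ler_pM //; lra.
by apply: le_trans; lra.
Qed.

Lemma log_der_ge l w z : expanding l -> cyl l w z ->
  (size w)%:R <= log_der l (size w) z.
Proof.
elim: w l z => [|b w ih] l z hl /=; first by rewrite /log_der /log_par big_ord0 addr0.
move=> [hz /(ih _ _ (expanding_shift hl))]; rewrite log_derS.
have := log_step_ge1 (hl 0%N) hz; rewrite -natr1; lra.
Qed.

Lemma log_der_le l w z (M : R) : expanding l -> (forall n, normc (l n) <= M) ->
  cyl l w z -> log_der l (size w) z <= (size w)%:R * (ln M + 1).
Proof.
elim: w l z => [|b w ih] l z hl hM /=.
  by rewrite /log_der /log_par big_ord0 addr0 mul0r.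
move=> [hz /(ih _ _ (expanding_shift hl) (fun n => hM n.+1))]; rewrite log_derS.
have h0 : ln (normc (l 0%N)) <= ln M.
  have h40 := hl 0%N; have hM0 := hM 0%N.
  by rewrite ler_ln ?posrE //; lra.
have : ln (normc z) <= 1.
  have /andP[h1 h2] := inB_norm hz.
  apply: (@le_trans _ _ (ln (1 + 1))); last by apply: le_ln1Dx; lra.
  by rewrite ler_ln ?posrE //; lra.
by rewrite -natr1 mulrDl mul1r; lra.
Qed.

Lemma log_orb_distortion l w z z' : expanding l -> cyl l w z -> cyl l w z' ->
  `|log_der l (size w) z - log_der l (size w) z'| <= 1.
Proof.
move=> hl hz hz'; have := log_orb_compare hl hl hz hz'.
have -> : par_dist l l (size w) = 0.
  rewrite /par_dist big1 // => i _.
  by rewrite divff ?subrr ?normc0 // expanding_neq0.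
have := inV_dist (cyl_inV_orb hz) (cyl_inV_orb hz').
have := normc_ge0 (z - z').
rewrite /log_der; set A := log_orb _ _ _; set B := log_orb _ _ _.
have -> : log_par l (size w) + A - (log_par l (size w) + B) = A - B by ring.
lra.
Qed.

(** A quadratic map stretches a segment by exactly its derivative at the midpoint, and the midpoint
    is [normc (z - z') / 2] away from [z]. *)
Lemma midpoint_step b (t z z' : R[i]) : 40 < normc t -> inB b z -> inB b z' -> z != z' ->
  36 * normc (z - z') <= normc (quad t z - quad t z') /\
  `|ln (normc (z - z')) + (ln (normc t) + ln (normc z))
      - ln (normc (quad t z - quad t z'))| <= 5 / 9 * normc (z - z').
Proof.
move=> ht hz hz' zz'.
have e0 : 0 < normc (z - z') by rewrite normc_gt0 subr_eq0.
have hs := normcD_inB hz hz'; have /andP[hz1 _] := inB_norm hz.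
rewrite normc_quadB; split.
  have : 40 * (9 / 5) * normc (z - z') <= normc t * normc (z + z') * normc (z - z').
    by rewrite ler_pM2r // ler_pM //; lra.
  lra.
have -> : normc t / 2 * normc (z - z') * normc (z + z')
  = normc (z - z') * (normc t * (normc (z + z') / 2)) by field.
rewrite lnM ?posrE //; last by rewrite mulr_gt0 ?divr_gt0 //; lra.
rewrite lnM ?posrE //; [|lra|lra].
rewrite (_ : _ - _ = ln (normc z) - ln (normc (z + z') / 2)); last by ring.
apply: (le_trans (@ln_lipschitz _ (9/10) _ _ _ hz1 _)) => //; first by lra.
have h1 := le_normcB (2 * z) (z + z'); have h2 := le_normcB (z + z') (2 * z).
rewrite (normcBC _ (2 * z)) in h2.
have e : 2 * z - (z + z') = z - z' by ring.
rewrite e normcM normc_nat in h1 h2.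
rewrite invf_div mulrC.
have : `|normc z - normc (z + z') / 2| <= normc (z - z') / 2 by rewrite ler_norml; lra.
lra.
Qed.

(** The errors of [midpoint_step] are summed along the word; again the term [normc (z - z') / 10]
    pays for the next step of the induction. *)
Lemma cyl_dist l w z z' : expanding l -> cyl l w z -> cyl l w z' -> z != z' ->
  `|ln (normc (z - z')) + log_der l (size w) z
     - ln (normc (orb l (size w) z - orb l (size w) z'))| + normc (z - z') / 10
  <= normc (orb l (size w) z - orb l (size w) z') / 10.
Proof.
elim: w l z z' => [|b w ih] l z z' hl.
  by rewrite /= /log_der /log_par big_ord0 /= !addr0 subrr normr0 add0r.
move=> [hz cz] [hz' cz'] zz'.
have [h1 h2] := midpoint_step (hl 0%N) hz hz' zz'.
have e0 : 0 < normc (z - z') by rewrite normc_gt0 subr_eq0.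
have qq : quad (l 0%N) z != quad (l 0%N) z' by rewrite -subr_eq0 -normc_gt0; lra.
have := ih _ _ _ (expanding_shift hl) cz cz' qq.
rewrite /size -/(size w) !orbS log_derS.
set E1 := normc (quad _ _ - _) in h1 h2 *; set A := log_der _ _ _.
set En := normc (_ - _); move: h2.
set B := ln _ + (ln _ + _) - _; set D := ln E1 + A - ln En => hB hD.
have := ler_normD B D.
have -> : B + D = ln (normc (z - z')) + (ln (normc (l 0%N)) + ln (normc z) + A) - ln En.
  by rewrite /B /D; ring.
lra.
Qed.

(** The final distance is at most 21/5, which bounds its logarithm too; 21/5, 21/50 from [cyl_dist]
    and 1 from distortion add up to less than 6. *)
Lemma cyl_diam l w z z' z0 : expanding l -> cyl l w z -> cyl l w z' -> cyl l w z0 ->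
  normc (z - z') <= expR (6 - log_der l (size w) z0).
Proof.
move=> hl hz hz' hz0; have [->|zz'] := eqVneq z z'.
  by rewrite subrr normc0 expR_ge0.
have h1 := cyl_dist hl hz hz' zz'; have h2 := log_orb_distortion hl hz hz0.
have h3 := inV_dist (cyl_inV_orb hz) (cyl_inV_orb hz').
have e0 : 0 < normc (z - z') by rewrite normc_gt0 subr_eq0.
suff : ln (normc (z - z')) <= 6 - log_der l (size w) z0.
  by rewrite -ler_expR lnK.
move: h1 h2 h3; set En : R := normc (orb _ _ _ - _) => h1 h2 hEn.
have hln : ln En <= 21 / 5.
  have [E0|E0] := leP En 0; first by rewrite ln0 //; lra.
  exact: le_trans (ltW (ln_sublinear E0)) hEn.
move: h2; rewrite ler_norml.
have := ler_norm (ln (normc (z - z')) + log_der l (size w) z - ln En); lra.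
Qed.

(** At the first letter where the words differ, the two orbits lie in opposite discs, at distance at
    least 9/5; pulling this back along the common prefix costs the derivative up to a constant
    factor. *)
Lemma cyl_separation l w w' z z' : expanding l -> size w = size w' -> w <> w' ->
  cyl l w z -> cyl l w' z' ->
  expR (-1 - log_der l (size w) z) <= normc (z - z').
Proof.
move=> hl; suff main : size w = size w' -> w <> w' -> cyl l w z -> cyl l w' z' ->
    0 < normc (z - z') /\
    -1 + normc (z - z') / 10 <= ln (normc (z - z')) + log_der l (size w) z.
  move=> ss' ww' hz hz'; have [e0 h] := main ss' ww' hz hz'.
  by rewrite -[leRHS]lnK ?posrE // ler_expR; lra.
elim: w w' l z z' hl => [|b w ih] [|b' w'] l z z' hl //= [ss'] ww'.
move=> [hz cz] [hz' cz'].
have [bb'|bb'] := eqVneq b b'; last first.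
  have h1 : 9 / 5 <= normc (z - z').
    by apply: (inB_far hz); move: hz' bb'; case: b {hz ww'}; case: b'.
  have h2 := log_der_ge hl (conj hz cz : cyl l (b :: w) z).
  have h3 := inV_dist (inB_inV hz) (inB_inV hz').
  have h4 : 0 <= ln (normc (z - z')) by apply: ln_ge0; lra.
  have h5 : 0 <= (size (b :: w))%:R :> R by [].
  by split; [lra|move: h2 h5; rewrite /=; lra].
rewrite -{}bb' in ww' hz'.
have ww2 : w <> w' by move=> e; apply: ww'; rewrite e.
have [e1] := ih _ _ _ _ (expanding_shift hl) ss' ww2 cz cz'.
have zz' : z != z' by apply/eqP => zz'; move: e1; rewrite zz' subrr normc0 ltxx.
have [h1 h2] := midpoint_step (hl 0%N) hz hz' zz'.
have e0 : 0 < normc (z - z') by rewrite normc_gt0 subr_eq0.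
move=> h3; split=> //.
by move: h2; rewrite log_derS ler_norml; lra.
Qed.

End Distortion.

(** * Inverse branches along a word *)

Section InverseBranches.
Context {R : realType}.
Implicit Types (l : nat -> R[i]) (t y z p : R[i]) (b : bool) (w : seq bool) (n : nat).

Definition branch t b y : R[i] := sg b * sqrtc (1 + 2 * (y - 1) / t).

Lemma branchK t b y : t != 0 -> quad t (branch t b y) = y.
Proof.
move=> t0; rewrite /quad /branch exprMn sqr_sqrtc expr2 sg_sqr.
by field.
Qed.

(** The principal square root has nonnegative real part, so [quad_inV_inB] puts it in the disc
    around 1; the other branch is its negative. *)
Lemma branch_inB t b y : 40 < normc t -> inV y -> inB b (branch t b y).
Proof.
move=> ht hy; have t0 : t != 0 by rewrite -normc_gt0; lra.
have := @quad_inV_inB _ t (branch t true y) ht; rewrite branchK // => /(_ hy).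
rewrite /branch [sg true]/sg mul1r Re_sqrtc_ge0 /inB.
set s := sqrtc _; rewrite {1}/sg.
have -> : sg b * s - sg b = sg b * (s - 1) by ring.
by rewrite normcM normc_sg (mul1r (normc _)).
Qed.

Fixpoint pull l w p : R[i] :=
  if w is b :: w' then branch (l 0) b (pull (shift l) w' p) else p.

Lemma pull_cyl l w p : expanding l -> inV p -> cyl l w (pull l w p).
Proof.
elim: w l => //= b w ih l hl hp; have h := ih _ (expanding_shift hl) hp.
by rewrite branchK ?expanding_neq0 //; split=> //; apply: branch_inB (cyl_inV h).
Qed.

Lemma orb_pull l w p : expanding l -> orb l (size w) (pull l w p) = p.
Proof.
elim: w l => // b w ih l hl; rewrite /size -/(size w) orbS /= branchK ?expanding_neq0 //.
exact: ih (expanding_shift hl).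
Qed.

End InverseBranches.

(** * Trapped orbits, their coding by signs, and escape *)

Section Trapped.
Context {R : realType}.
Implicit Types (l : nat -> R[i]) (z p : R[i]) (b : bool) (w : seq bool) (n : nat).

Definition trapped l z := forall n, inV (orb l n z).

Lemma trapped_quad l z : trapped l z -> trapped (shift l) (quad (l 0) z).
Proof. by move=> h n; rewrite -orbS. Qed.

Definition itinerary l z : nat -> bool := fun n => 0 <= complex.Re (orb l n z).

Lemma trapped_cyl l z n : expanding l -> trapped l z -> cyl l (mkseq (itinerary l z) n) z.
Proof.
elim: n l z => [|n ih] l z hl hz; first exact: (hz 0%N).
rewrite /mkseq /= -[1%N]addn0 iotaDl -map_comp; split.
  exact: quad_inV_inB (hl 0%N) (hz 1%N).
have := ih _ _ (expanding_shift hl) (trapped_quad hz).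
congr cyl; apply: eq_map => i /=.
by rewrite /itinerary -orbS.
Qed.

Lemma cyl_trapped l z s : (forall n, cyl l (mkseq s n) z) -> trapped l z.
Proof. by move=> h n; have := cyl_inV_orb (h n); rewrite size_mkseq. Qed.

Lemma quad_continuous t z (e : R) : 0 < e ->
  exists2 d : R, 0 < d & forall y, normc (y - z) <= d -> normc (quad t y - quad t z) <= e.
Proof.
move=> e0; pose k := normc t * (normc z + 1) + 1.
have k0 : 0 < k by rewrite ltr_wpDl // mulr_ge0 ?addr_ge0 ?normc_ge0.
exists (Num.min 1 (e / k)); first by rewrite lt_min ltr01 divr_gt0.
move=> y; rewrite le_min => /andP[h1 h2]; rewrite normc_quadB.
have h3 : normc (y + z) <= 2 * (normc z + 1).
  have -> : y + z = (y - z) + 2 * z by ring.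
  by rewrite (le_trans (le_normcD _ _)) // normcM normc_nat; have := normc_ge0 z; lra.
move: h2; rewrite ler_pdivlMr // /k => h2; apply: le_trans h2.
have t0 := normc_ge0 t; have d0 := normc_ge0 (y - z).
apply: (@le_trans _ _ (normc t / 2 * normc (y - z) * (2 * (normc z + 1)))).
  by rewrite ler_wpM2l // mulr_ge0 // divr_ge0.
by have : 0 <= normc (y - z) * 1; lra.
Qed.

Lemma orb_continuous l n z (e : R) : 0 < e ->
  exists2 d : R, 0 < d & forall y, normc (y - z) <= d -> normc (orb l n y - orb l n z) <= e.
Proof.
elim: n e => [|n ih] e e0; first by exists e.
have [d1 d10 h1] := quad_continuous (l n) (orb l n z) e0.
have [d d0 h] := ih _ d10; exists d => // y hy; exact/h1/h.
Qed.

Lemma closed_normc_ball (c z : R[i]) (r : R) :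
  (forall e, 0 < e -> exists2 y, normc (y - z) <= e & normc (y - c) <= r) ->
  normc (z - c) <= r.
Proof.
move=> h; apply/ler_addgt0Pr => e /h[y h1 h2].
by have := normc_triangle y z c; rewrite (normcBC z y); lra.
Qed.

Lemma cyl_closed l w z :
  (forall e, 0 < e -> exists2 y, normc (y - z) <= e & cyl l w y) -> cyl l w z.
Proof.
elim: w l z => [|b w ih] l z h; first exact: closed_normc_ball.
split; first by apply: closed_normc_ball => e /h[y h1 [h2 _]]; exists y.
apply: ih => e e0; have [d d0 hd] := quad_continuous (l 0) z e0.
by have [y h1 [_ h2]] := h _ d0; exists (quad (l 0) y) => //; exact: hd.
Qed.

(** The centre with the larger index lies in both intervals of radius [d] around [a n] and [a m], so
    every left end point is below every right one. The supremum of the left end points is then a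
    common point. *)
Lemma nested_limit (a d : nat -> R) :
  (forall n m, (n <= m)%N -> `|a n - a m| <= d n) -> exists c, forall n, `|a n - c| <= d n.
Proof.
move=> h; have ub n m : a n - d n <= a m + d m.
  have [nm|/ltnW mn] := leqP n m.
    by have := h _ _ nm; have := h _ _ (leqnn m); rewrite subrr normr0 ler_norml; lra.
  by have := h _ _ mn; have := h _ _ (leqnn n); rewrite subrr normr0 ler_norml; lra.
pose A := [set a n - d n | n in setT].
have A0 : A !=set0 by exists (a 0%N - d 0%N), 0%N.
exists (sup A) => n; rewrite ler_norml; apply/andP; split.
  rewrite lerBrDr addrC lerBlDr; apply: ge_sup => // _ [m _ <-]; exact: ub.
rewrite lerBlDr addrC -lerBlDr; apply: ub_le_sup; last by exists n.
by exists (a 0%N + d 0%N) => _ [m _ <-]; exact: ub.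
Qed.

Lemma ltr_archi_nat (x : R) : exists n : nat, x < n%:R.
Proof. by exists (Num.truncn x).+1; exact: truncnS_gt. Qed.

Lemma expR_small (c e : R) : 0 < e -> exists N : nat, forall n, (N <= n)%N -> expR (c - n%:R) <= e.
Proof.
move=> e0; have [N hN] := ltr_archi_nat (c - ln e); exists N => n Nn.
rewrite -[leRHS]lnK ?posrE // ler_expR; have : N%:R <= n%:R :> R by rewrite ler_nat.
lra.
Qed.

Lemma mkseq_prefix (s : nat -> bool) n m : (n <= m)%N -> exists v, mkseq s m = mkseq s n ++ v.
Proof.
move=> nm; exists (map s (iota n (m - n))).
by rewrite /mkseq -map_cat -[in X in _ ++ X](add0n n) -iotaD subnKC.
Qed.

(** The preimages of 1 along the prefixes of [s] form a Cauchy sequence, because cylinders shrink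
    exponentially; its limit stays in each cylinder by [cyl_closed]. *)
Lemma trapped_of_itinerary l (s : nat -> bool) : expanding l ->
  exists z, forall n, cyl l (mkseq s n) z.
Proof.
move=> hl; pose x n := pull l (mkseq s n) 1.
have hx n m : (n <= m)%N -> cyl l (mkseq s n) (x m).
  move=> /(mkseq_prefix s)[v e]; apply: (@cyl_cat _ _ _ v); rewrite -e.
  exact/pull_cyl/(sg_inV true).
have dx n m : (n <= m)%N -> normc (x n - x m) <= expR (6 - n%:R).
  move=> nm; apply: (le_trans (cyl_diam hl (hx _ _ (leqnn n)) (hx _ _ nm) (hx _ _ nm))).
  by rewrite ler_expR lerD2l lerN2 -[in leLHS](size_mkseq s n) log_der_ge //; exact: hx.
have [a ha] : exists a, forall n, `|complex.Re (x n) - a| <= expR (6 - n%:R).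
  apply: (nested_limit (a := fun n => complex.Re (x n))) => n m nm.
  by apply: le_trans (dx _ _ nm); apply: le_trans (ge_Re_normc _); case: (x n) (x m) => [? ?] [].
have [c hc] : exists c, forall n, `|complex.Im (x n) - c| <= expR (6 - n%:R).
  apply: (nested_limit (a := fun n => complex.Im (x n))) => n m nm.
  by apply: le_trans (dx _ _ nm); apply: le_trans (ge_Im_normc _); case: (x n) (x m) => [? ?] [].
exists (a +i* c)%C => n; apply: cyl_closed => e e0.
have [N hN] := @expR_small 6 (e / 2) ltac:(lra).
exists (x (maxn N n)); last by apply: hx; rewrite leq_maxr.
apply: (le_trans (normc_le_ReIm _)); have := hN _ (leq_maxl N n).
have := ha (maxn N n); have := hc (maxn N n).
by case: (x (maxn N n)) => [? ?] /=; lra.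
Qed.

Lemma normc_quad_ge t z : 40 < normc t -> 20 * normc z ^+ 2 - 21 <= normc (quad t z).
Proof.
move=> ht; have h1 := le_normcB (t / 2 * (z ^+ 2 - 1)) (-1).
have -> : quad t z = t / 2 * (z ^+ 2 - 1) - (-1) by rewrite /quad opprK.
apply: le_trans h1; rewrite normcN normc1 !normcM normcV normc_nat.
have h2 := le_normcB (z ^+ 2) 1; rewrite normc1 normc_sqr in h2.
have [h3|h3] := leP (normc z ^+ 2) 1.
  have : 0 <= normc t / 2 * normc (z ^+ 2 - 1) by rewrite mulr_ge0 ?divr_ge0 ?normc_ge0.
  lra.
have : 20 * (normc z ^+ 2 - 1) <= normc t / 2 * normc (z ^+ 2 - 1).
  by rewrite ler_pM //; lra.
lra.
Qed.

(** Outside [inV] the modulus exceeds 11/10, and 20 times the square of 11/10, minus 21, is at least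
    3. *)
Lemma escape_step t z : 40 < normc t -> ~ inV z -> 3 <= normc (quad t z).
Proof.
move=> ht /negP; rewrite -ltNge => hz; apply: le_trans (normc_quad_ge z ht).
have := le_normcD z (-1); rewrite normcN normc1 => h.
by have : 11/10 * (11/10) <= normc z ^+ 2; [rewrite expr2 ler_pM //; lra|lra].
Qed.

Lemma escape_double t z : 40 < normc t -> 2 <= normc z -> 2 * normc z <= normc (quad t z).
Proof.
move=> ht hz; apply: le_trans (normc_quad_ge z ht).
have : 2 * normc z <= normc z ^+ 2 by rewrite expr2 ler_wpM2r // normc_ge0.
lra.
Qed.

Lemma escape_growth l N n z : expanding l -> 2 <= normc (orb l N z) ->
  n%:R <= normc (orb l (N + n) z) /\ 2 <= normc (orb l (N + n) z).
Proof.
move=> hl h; elim: n => [|n [ih1 ih2]]; first by rewrite addn0 normc_ge0.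
rewrite addnS -natr1 /=; have := escape_double (hl (N + n)%N) ih2; lra.
Qed.

End Trapped.

(** * The spherical metric and the Julia set *)

Section SphericalBounds.
Context {R : realType}.
Implicit Types (z w : R[i]) (x : R) (p q : sphere R).

Lemma sin_le_id x : 0 <= x -> sin x <= x.
Proof.
rewrite le_eqVlt => /predU1P[<-|x0]; first by rewrite sin0.
have [c _] := MVT x0 (fun y _ => is_derive_sin y) (continuous_subspaceT (@continuous_sin R)).
rewrite sin0 !subr0 => ->; rewrite ler_piMl ?cos_le1 //; exact: ltW.
Qed.

Lemma sin_ge_quarter x : 0 <= x <= pi / 2 -> x / 4 <= sin x.
Proof.
(* If [cos x] is at least 1/2, the mean value theorem gives [sin x >= x / 2]. Otherwise
   [sin x >= 1/2], which suffices because [pi / 2 < 2]. *)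
move=> /andP[x0 xpi]; have [h|h] := leP (1/2) (cos x).
  move: x0; rewrite le_eqVlt => /predU1P[<-|x0]; first by rewrite sin0 mul0r.
  have [c] := MVT x0 (fun y _ => is_derive_sin y) (continuous_subspaceT (@continuous_sin R)).
  rewrite in_itv /= sin0 !subr0 => /andP[c0 cx] ->.
  have : cos x <= cos c.
    by rewrite ltW // ltr_cos // in_itv /=; have := pi_ge0 R; lra.
  by move=> hc; have : x * (1/2) <= x * cos c; [rewrite ler_pM2l //; lra|lra].
have s0 : 0 <= sin x by apply: sin_ge0_pi; have := pi_ge0 R; lra.
have c0 : 0 <= cos x by apply: cos_ge0_pihalf; have := pi_ge0 R; lra.
have [/andP[_ h2] _] := @pihalf_02_cos_pihalf R.
have := cos2Dsin2 x => h3.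
have : 1/2 <= sin x by nra.
lra.
Qed.

Lemma dot3_bound (u v : R * R * R) : dot3 u u = 1 -> dot3 v v = 1 -> -1 <= dot3 u v <= 1.
Proof.
case: u => -[a b] c; case: v => -[x y] z; rewrite /dot3 /= => hu hv.
have h1 := sqr_ge0 (a - x); have h2 := sqr_ge0 (b - y).
have h3 := sqr_ge0 (c - z); have h4 := sqr_ge0 (a + x).
have h5 := sqr_ge0 (b + y); have h6 := sqr_ge0 (c + z).
by apply/andP; split; lra.
Qed.

Lemma cos_sph_dist p q : cos (sph_dist p q) = dot3 (stereo p) (stereo q).
Proof. by rewrite acosK // in_itv /= dot3_bound ?stereo_unit. Qed.

Lemma sph_dist_itv p q : 0 <= sph_dist p q <= pi.
Proof. by rewrite /sph_dist acos_ge0 ?acos_lepi ?dot3_bound ?stereo_unit. Qed.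

(** With [t] the angle, the squared chord [2 * (1 - dot3 _ _)] equals [4 * sin (t / 2) ^+ 2]. Metric
    estimates on the sphere thereby reduce to the rational expressions [dot3_finite] and
    [dot3_infinite]. *)
Lemma sph_dist_chord p q :
  2 * (1 - dot3 (stereo p) (stereo q)) <= sph_dist p q ^+ 2
    <= 32 * (1 - dot3 (stereo p) (stereo q)).
Proof.
have /andP[h0 hpi] := sph_dist_itv p q.
set t := sph_dist p q in h0 hpi *.
have -> : 1 - dot3 (stereo p) (stereo q) = 2 * sin (t / 2) ^+ 2.
  rewrite -cos_sph_dist -/t [in LHS](_ : t = t / 2 + t / 2); last by field.
  by rewrite cosD; have := cos2Dsin2 (t / 2); lra.
have s0 : 0 <= sin (t / 2) by apply: sin_ge0_pi; lra.
have := @sin_le_id (t / 2); have := @sin_ge_quarter (t / 2).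
move: (sin (t / 2)) s0 => s s0 h1 h2.
have {}h1 : t / 2 / 4 <= s by apply: h1; lra.
have {}h2 : s <= t / 2 by apply: h2; lra.
by apply/andP; split; nra.
Qed.

Let sqr_normcE z : normc z ^+ 2 = complex.Re z ^+ 2 + complex.Im z ^+ 2.
Proof. by case: z => a b /=; rewrite sqr_sqrtr // addr_ge0 ?sqr_ge0. Qed.

Lemma dot3_finite z w : 1 - dot3 (stereo (Some z)) (stereo (Some w)) =
  2 * normc (z - w) ^+ 2 / ((1 + normc z ^+ 2) * (1 + normc w ^+ 2)).
Proof.
rewrite /dot3 /= !sqr_normcE; case: z => a b; case: w => c d /=.
by field; rewrite !gt_eqF // ltr_wpDr // addr_ge0 ?sqr_ge0.
Qed.

Lemma dot3_infinite z : 1 - dot3 (stereo None) (stereo (Some z)) = 2 / (1 + normc z ^+ 2).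
Proof.
rewrite /dot3 /= !mul0r !add0r mul1r; field.
by rewrite gt_eqF // ltr_wpDr // sqr_ge0.
Qed.

Lemma sph_dist_le z w : sph_dist (Some z) (Some w) <= 8 * normc (z - w).
Proof.
have /andP[t0 _] := sph_dist_itv (Some z) (Some w).
have /andP[_] := sph_dist_chord (Some z) (Some w).
rewrite dot3_finite => h.
rewrite -(@ler_pXn2r _ 2) ?nnegrE ?mulr_ge0 ?normc_ge0 //; apply: (le_trans h).
have k (y : R[i]) : 1 <= 1 + normc y ^+ 2 by rewrite lerDl sqr_ge0.
have k2 : 1 <= (1 + normc z ^+ 2) * (1 + normc w ^+ 2) by rewrite mulr_ege1.
have : 2 * normc (z - w) ^+ 2 / ((1 + normc z ^+ 2) * (1 + normc w ^+ 2))
   <= 2 * normc (z - w) ^+ 2.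
  by rewrite ler_pdivrMr ?(lt_le_trans ltr01 k2) // ler_peMr // mulr_ge0 ?sqr_ge0.
rewrite exprMn; lra.
Qed.

Lemma sph_dist_ge z w : inV z -> inV w -> normc (z - w) / 6 <= sph_dist (Some z) (Some w).
Proof.
move=> hz hw; have /andP[t0 _] := sph_dist_itv (Some z) (Some w).
have /andP[h _] := sph_dist_chord (Some z) (Some w); move: h.
rewrite dot3_finite => h.
rewrite -(@ler_pXn2r _ 2) ?nnegrE ?divr_ge0 ?normc_ge0 //; apply: le_trans h.
have k (y : R[i]) : inV y -> 0 < 1 + normc y ^+ 2 <= 11.
  rewrite /inV => hy; have h := le_normcB y 1; rewrite normc1 in h.
  have y0 := normc_ge0 y; apply/andP; split; first by have := sqr_ge0 (normc y); lra.
  have : normc y ^+ 2 <= (31/10) ^+ 2 by rewrite ler_sqr ?nnegrE //; lra.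
  lra.
have /andP[z0 z1] := k _ hz; have /andP[w0 w1] := k _ hw.
have k2 : (1 + normc z ^+ 2) * (1 + normc w ^+ 2) <= 11 * 11 by rewrite ler_pM // ltW.
rewrite mulrA ler_pdivlMr ?mulr_gt0 //.
apply: (@le_trans _ _ ((normc (z - w) / 6) ^+ 2 * (11 * 11))).
  by rewrite ler_wpM2l // sqr_ge0.
have := sqr_ge0 (normc (z - w)); rewrite exprMn; lra.
Qed.

Lemma sph_dist_infty z x : 0 < x -> x <= normc z -> sph_dist (Some z) None <= 8 / x.
Proof.
move=> x0 xz; rewrite sph_distC; have /andP[t0 _] := sph_dist_itv None (Some z).
have /andP[_] := sph_dist_chord None (Some z).
rewrite dot3_infinite => h.
rewrite -(@ler_pXn2r _ 2) ?nnegrE ?divr_ge0 ?(ltW x0) //; apply: (le_trans h).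
rewrite expr_div_n mulrA ler_pdivrMr; last by have := sqr_ge0 (normc z); lra.
rewrite mulrAC ler_pdivlMr ?exprn_gt0 //.
have : x ^+ 2 <= normc z ^+ 2 by rewrite ler_sqr ?nnegrE ?normc_ge0 // ltW.
lra.
Qed.

(** Small spherical balls around a finite point avoid infinity and are small in the plane, although
    no bound on the second point is known beforehand. *)
Lemma sph_ball_finite z (d : R) : 0 < d -> exists2 e, 0 < e &
  forall p, sph_dist (Some z) p < e -> exists2 y, p = Some y & normc (y - z) <= d.
Proof.
move=> d0; set A := 1 + normc z ^+ 2.
have A1 : 1 <= A by rewrite lerDl sqr_ge0.
have A0 : 0 < A by lra.
exists (Num.min 1 d / A); first by rewrite divr_gt0 // lt_min ltr01.
move=> p; have /andP[t0 _] := sph_dist_itv (Some z) p.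
have /andP[h _] := sph_dist_chord (Some z) p; move: t0 h.
set t := sph_dist _ _ => t0 h; rewrite ltr_pdivlMr // lt_min => /andP[h1 h2].
have h3 : (t * A) ^+ 2 <= 1 by rewrite expr_le1 // ?mulr_ge0 // ltW.
have h4 : t ^+ 2 * A <= 1.
  apply: le_trans h3; rewrite exprMn ler_wpM2l ?sqr_ge0 // expr2 ler_peMl //; lra.
case: p @t t0 h h1 h2 h3 h4 => [y|] t t0 h h1 h2 h3 h4; last first.
  have /andP[] := sph_dist_chord None (Some z).
  rewrite sph_distC -/t dot3_infinite -/A mulrA ler_pdivrMr // => h5 _.
  by exfalso; lra.
exists y => //; rewrite normcBC -(@ler_pXn2r _ 2) ?nnegrE ?normc_ge0 ?(ltW d0) //.
apply: (@le_trans _ _ ((t * A) ^+ 2)); last first.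
  by rewrite ler_pXn2r ?nnegrE ?mulr_ge0 // ltW.
move: h; rewrite dot3_finite -/A mulrA ler_pdivrMr; last first.
  by rewrite mulr_gt0 //; have := sqr_ge0 (normc y); lra.
(* The unknown size of [y] is bounded through [normc (z - y)], and that term is absorbed on the left
   since [t ^+ 2 * A <= 1]. *)
have : normc y ^+ 2 <= 2 * normc z ^+ 2 + 2 * normc (z - y) ^+ 2.
  have h5 : normc y <= normc z + normc (z - y).
    by rewrite normcBC; have := le_normcB y z; lra.
  have := sqr_ge0 (normc z - normc (z - y)).
  have : normc y ^+ 2 <= (normc z + normc (z - y)) ^+ 2.
    by rewrite ler_sqr ?nnegrE ?addr_ge0 ?normc_ge0.
  lra.
rewrite -[normc z ^+ 2](addrK 1) [_ + 1]addrC -/A => h5 h6.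
have : t ^+ 2 * (A * (1 + normc y ^+ 2)) <= t ^+ 2 * A * (2 * A + 2 * normc (z - y) ^+ 2).
  by rewrite -mulrA ler_wpM2l ?sqr_ge0 // ler_wpM2l //; lra.
have : t ^+ 2 * A * normc (z - y) ^+ 2 <= normc (z - y) ^+ 2.
  by rewrite ler_piMl // sqr_ge0.
rewrite exprMn; lra.
Qed.

Lemma sph_ball_infinite z : sph_dist None (Some z) < 1/2 -> 3 <= normc z.
Proof.
move=> h1; have /andP[t0 _] := sph_dist_itv None (Some z).
have /andP[h _] := sph_dist_chord None (Some z); move: h.
rewrite dot3_infinite => h.
have h2 : sph_dist None (Some z) ^+ 2 < (1/2) ^+ 2 by rewrite ltr_sqr ?nnegrE //; lra.
have := le_lt_trans h h2; rewrite mulrA ltr_pdivrMr; last by have := sqr_ge0 (normc z); lra.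
move=> h3; rewrite -ler_sqr ?nnegrE ?normc_ge0 //; lra.
Qed.

End SphericalBounds.

(** * Normal families and the description of the Julia set *)

Lemma infinitely_often_subsequence (P : nat -> Prop) :
  (forall K, exists2 k, (K <= k)%N & P k) ->
  exists phi : nat -> nat, {homo phi : m n / (m < n)%N} /\ forall n, P (phi n).
Proof.
move=> h; have /choice[f hf] : forall K, exists k, (K <= k)%N /\ P k.
  by move=> K; have [k ? ?] := h K; exists k.
pose fix phi n := if n is m.+1 then f (phi m).+1 else f 0%N.
exists phi; split; last by case=> [|n]; exact: (hf _).2.
by apply: homo_ltn => [x y z|n]; [exact: ltn_trans|exact: (hf _).1].
Qed.

Lemma homo_ltn_ge (phi : nat -> nat) n : {homo phi : m n / (m < n)%N} -> (n <= phi n)%N.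
Proof. by move=> h; elim: n => // n ih; exact: leq_ltn_trans ih (h _ _ (ltnSn n)). Qed.

Section SphereTopology.
Context {R : realType}.
Implicit Types (p q : sphere R) (l : nat -> R[i]) (z : R[i]).

Lemma nbhs_sphereP p (A : set (sphere R)) :
  nbhs p A <-> exists2 e, 0 < e & forall q, sph_dist p q < e -> A q.
Proof.
split.
  by move=> /nbhs_ballP[e /= e0 h]; exists e.
by move=> [e e0 h]; apply/nbhs_ballP; exists e => //= q; rewrite ballEmdist => /h.
Qed.

Lemma family_cvgP (fam : set (sphere R) -> Prop) (u : nat -> sphere R -> sphere R) g :
  {family fam, u @ \oo --> g} <-> forall A, fam A -> forall e, 0 < e ->
    exists N, forall n, (N <= n)%N -> forall p, A p -> sph_dist (g p) (u n p) < e.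
Proof.
split=> [/fam_cvgP h A fA e e0|h]; first have hA := h A fA.
  have [|N _ hN] := hA [set f | forall p, A p -> sph_dist (g p) (f p) < e].
    apply/uniform_nbhs; exists [set pq | ball pq.1 e pq.2].
    split; first exact: (entourage_ball _ (PosNum e0)).
    by move=> f /= hf p /hf; rewrite ballEmdist.
  by exists N => n /hN.
apply/fam_cvgP => A fA; have hA := h A fA => B /uniform_nbhs[E []]; rewrite -entourage_ballE.
move=> [e /= e0 eE] hB; have [N hN] := hA e e0.
exists N => // n /= /hN hn; apply: hB => p Ap /=; apply: eE => /=.
by rewrite ballEmdist; exact: hn.
Qed.

(** Normality only gives uniform convergence on compact sets; this supplies a compact set containing
    a point and points tending to it. A filter that does not cluster at [p] lives on finitely many
    of the [y n]. *)
Lemma compact_convergent_sequence p (y : nat -> sphere R) (N0 : nat) :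
  (forall e, 0 < e -> exists N, forall n, (N <= n)%N -> sph_dist p (y n) < e) ->
  compact (p |` [set y n | n in [set n | (N0 <= n)%N]]).
Proof.
move=> cv F FF FA; have [h|h] := pselect (cluster F p); first by exists p; split => //; left.
have [B [U [FB pU BU]]] : exists B U, [/\ F B, nbhs p U & forall x, B x -> ~ U x].
  apply: contrapT => h2; apply: h => B U FB pU; apply: contrapT => h3.
  by apply: h2; exists B, U; split=> // x Bx Ux; apply: h3; exists x.
have /nbhs_sphereP[e e0 he] := pU; have [N hN] := cv e e0.
set A := _ `|` _ in FA *.
have fin : compact (y @` `I_N `&` A).
  by apply: finite_compact; apply: finite_setIl; exact/finite_image/finite_II.
have [|q [[_ Aq] cq]] := fin F FF; last by exists q; split.
apply: filterS2 FA FB => q Aq Bq; split=> //.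
case: Aq => [qp|[n _ qn]]; first by case: (BU _ Bq); rewrite qp; exact: nbhs_singleton.
exists n => //=; rewrite ltnNge; apply/negP => Nn.
by apply: (BU _ Bq); rewrite -qn; exact/he/hN.
Qed.

Lemma escape_neighborhood l p : expanding l -> ~ (exists2 z, p = Some z & trapped l z) ->
  exists N, nbhs p [set q : sphere R | forall z, q = Some z -> 2 <= normc (orb l N z)].
Proof.
move=> hl; case: p => [z|] h; last first.
  exists 0%N; apply/nbhs_sphereP; exists (1/2); first by lra.
  by move=> q + z qz; rewrite qz => /sph_ball_infinite /=; lra.
have /existsNP[N hN] : ~ trapped l z by move=> hz; apply: h; exists z.
exists N.+1; have h3 := escape_step (hl N) hN.
have [d d0 hd] := @orb_continuous _ l N.+1 z 1 ltr01.
have [e e0 he] := sph_ball_finite z d0.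
apply/nbhs_sphereP; exists e => // q /he[y -> /hd hy] _ [<-].
have := le_normcB (orb l N.+1 z) (orb l N.+1 y).
by rewrite normcBC; move: hy h3; rewrite -/(orb l N.+1 z); lra.
Qed.

Lemma escape_fatou l p : expanding l -> ~ (exists2 z, p = Some z & trapped l z) ->
  fatou_set l p.
Proof.
move=> hl /(escape_neighborhood hl)[N hN].
set U0 : set (sphere R) := [set q | _] in hN.
exists (interior U0); first by split; [exact: open_interior|exact: hN].
move=> u hu; have /choice[j hj] : forall k, exists j, compn l j.+1 = u k.
  by move=> k; have [j _ <-] := hu k; exists j.
(* Either one iterate recurs infinitely often and gives a constant subsequence, or the indices tend
   to infinity and the whole sequence converges uniformly to the point at infinity. *)
have [[m hm]|hj_infty] := pselect (exists m, forall K, exists2 k, (K <= k)%N & j k = m).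
  have [phi [hphi hjm]] := infinitely_often_subsequence hm.
  exists phi; split=> //; exists (compn l m.+1); apply/family_cvgP => A _ e e0.
  by exists 0%N => n _ p' _; rewrite /= -hj hjm sph_distxx.
have infty M : exists K, forall k, (K <= k)%N -> (M <= j k)%N.
  elim: M => [|M [K hK]]; first by exists 0%N.
  have /existsNP[K' hK'] : ~ forall K, exists2 k, (K <= k)%N & j k = M.
    by move=> h; apply: hj_infty; exists M.
  exists (maxn K K') => k; rewrite geq_max => /andP[Kk K'k].
  rewrite ltn_neqAle hK // andbT; apply/eqP => jk.
  by apply: hK'; exists k.
exists id; split=> //; exists (fun=> None); apply/family_cvgP => A [_ AU] e e0.
have [n0 hn0] := ltr_archi_nat (8 / e).
have [K hK] := infty (N + n0)%N; exists K => k /hK hk q /AU /interior_subset Uq.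
rewrite /= -hj sph_distC; case: q Uq => [z|] Uq; last by rewrite compn_None sph_distxx.
rewrite compn_Some.
have [m em] : exists m, (j k).+1 = (N + (n0 + m))%N.
  by exists ((j k).+1 - (N + n0))%N; lia.
have [h1 h2] := @escape_growth _ l N (n0 + m) z hl (Uq _ erefl).
have n0gt : 0 < n0%:R :> R by apply: lt_trans hn0; rewrite divr_gt0.
rewrite em; apply: (@le_lt_trans _ _ (8 / n0%:R)).
  by apply: sph_dist_infty => //; apply: le_trans h1; rewrite ler_nat leq_addr.
by rewrite ltr_pdivrMr // mulrC -ltr_pdivrMr.
Qed.

(* Arbitrarily close to z some y_n satisfies f^n(y_n) = -+1, the sign opposite to
   that of f^n(z), so no subsequence of f^n is equicontinuous at z. *)
Lemma trapped_julia l z : expanding l -> trapped l z -> julia_set l (Some z).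
Proof.
move=> hl hz [U [oU zU] nU].
pose w n := mkseq (itinerary l z) n.
pose p n : R[i] := sg (~~ itinerary l z n).
pose y n := pull l (w n) (p n).
have wz n : cyl l (w n) z by exact: trapped_cyl.
have wy n : cyl l (w n) (y n) by apply: pull_cyl => //; exact: sg_inV.
have oy n : orb l n (y n) = p n by rewrite -{1}(size_mkseq (itinerary l z) n) orb_pull.
(* Opposite discs are 9/5 apart, and on [inV] the spherical distance is at least a sixth of the
   planar one. *)
have far n : 3 / 10 <= sph_dist (Some (orb l n z)) (Some (orb l n (y n))).
  apply: le_trans (sph_dist_ge (hz n) _); last by rewrite oy; exact: sg_inV.
  have := inB_far (quad_inV_inB (hl n) (hz n.+1)) (sg_inB (~~ itinerary l z n)).
  by rewrite oy -/(p n); lra.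
have cv e : 0 < e -> exists N, forall n, (N <= n)%N -> normc (z - y n) <= e.
  move=> e0; have [N hN] := @expR_small R 6 e e0; exists N => n /hN; apply: le_trans.
  apply: (le_trans (cyl_diam hl (wz n) (wy n) (wz n))).
  by rewrite ler_expR lerD2l lerN2 -[in leLHS](size_mkseq (itinerary l z) n) log_der_ge.
have scv e : 0 < e -> exists N, forall n, (N <= n)%N -> sph_dist (Some z) (Some (y n)) < e.
  move=> e0; have [|N hN] := cv (e / 16); first by rewrite divr_gt0.
  by exists N => n /hN h; apply: (le_lt_trans (sph_dist_le _ _)); lra.
have [e e0 he] := (nbhs_sphereP _ _).1 (open_nbhs_nbhs (conj oU zU)).
have [N0 hN0] := scv e e0.
set A : set (sphere R) :=
  (Some z : sphere R) |` [set (Some (y n) : sphere R) | n in [set n | (N0 <= n)%N]].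
have [|phi [hphi [g /family_cvgP hg]]] := nU (fun n => compn l n.+1).
  by move=> k; exists k.
(* The path from [f^n(z)] to [f^n(y_n)] through [g(z)], [F(z)], [F(y_n)] and [g(y_n)] has five legs
   of at most 1/40 each, in total less than 3/10. *)
have [||k0 hk0] := hg A _ (1 / 40); [|by lra|].
  split; first exact: (@compact_convergent_sequence (Some z) (fun n => Some (y n)) N0 scv).
  by move=> _ [->|[n n0 <-]] //; exact/he/hN0.
set F := orb l (phi k0).+1.
have [d d0 hd] := @orb_continuous _ l (phi k0).+1 z (1/320) ltac:(lra).
have [N1 hN1] := cv d d0.
(* Here [n] is large enough for uniform convergence, for [y n] to lie in [A], and for the fixed
   iterate [F] to barely separate [z] and [y n]. *)
pose k := maxn k0 (maxn N0 N1); set n := (phi k).+1.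
have nk : (k <= n)%N by apply: leq_trans (leqnSn _); exact: homo_ltn_ge.
have nN0 : (N0 <= n)%N by apply: leq_trans nk; rewrite leq_max leq_maxl orbT.
have nN1 : (N1 <= n)%N by apply: leq_trans nk; rewrite leq_max leq_maxr orbT.
have Az : A (Some z) by left.
have Ay : A (Some (y n)) by right; exists n.
have near_g m (v : R[i]) : A (Some v) -> (k0 <= m)%N ->
    sph_dist (g (Some v)) (Some (orb l (phi m).+1 v)) < 1 / 40.
  move=> Aq km; have := hk0 m km _ Aq.
  by rewrite /= -[fsph _ _]/(compn l (phi m).+1 (Some v)) compn_Some.
have kk : (k0 <= k)%N by rewrite leq_maxl.
have := far n.
have h1 := near_g k _ Az kk; have h2 := near_g k _ Ay kk.
have h3 := near_g k0 _ Az (leqnn _); have h4 := near_g k0 _ Ay (leqnn _).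
have h5 : sph_dist (Some (F z)) (Some (F (y n))) <= 1 / 40.
  apply: (le_trans (sph_dist_le _ _)).
  have := hd (y n); rewrite !(normcBC _ z) (normcBC (orb _ _ _)) => /(_ (hN1 _ nN1)).
  by rewrite -/F; lra.
have t1 := sph_dist_triangle (g (Some z)) (Some (orb l n z)) (Some (orb l n (y n))).
have t2 := sph_dist_triangle (g (Some (y n))) (g (Some z)) (Some (orb l n (y n))).
have t3 := sph_dist_triangle (Some (F z)) (g (Some z)) (g (Some (y n))).
have t4 := sph_dist_triangle (Some (F (y n))) (Some (F z)) (g (Some (y n))).
rewrite sph_distC in h1; rewrite sph_distC in h4; rewrite -/n -/F in h1 h2 h3 h4.
lra.
Qed.

Lemma julia_setE l : expanding l -> julia_set l = [set Some z | z in trapped l].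
Proof.
move=> hl; apply/seteqP; split=> [p hp|_ [z hz <-]]; last exact: trapped_julia.
by apply: contrapT => h; apply: hp; apply: escape_fatou => // -[z pz hz]; apply: h; exists z.
Qed.

End SphereTopology.

(** * Partition sums *)

Section Words.

Definition words n : seq (seq bool) := [seq val t | t <- enum {: n.-tuple bool}].

Lemma mem_words n w : (w \in words n) = (size w == n).
Proof.
apply/mapP/idP => [[t _ ->]|sw]; first by rewrite size_tuple.
by exists (Tuple sw); rewrite ?mem_enum.
Qed.

Lemma uniq_words n : uniq (words n).
Proof. by rewrite map_inj_uniq ?enum_uniq //; exact: val_inj. Qed.

Lemma size_words n : size (words n) = (2 ^ n)%N.
Proof. by rewrite size_map -cardE card_tuple card_bool. Qed.

Lemma words_add m n : perm_eq (words (m + n)) [seq u ++ v | u <- words m, v <- words n].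
Proof.
apply: uniq_perm; first exact: uniq_words.
  apply: allpairs_uniq; rewrite ?uniq_words // => -[u v] [u' v'] /=.
  move=> /allpairsPdep[? [? [+ + [-> ->]]]] /allpairsPdep[? [? [+ + [-> ->]]]].
  rewrite !mem_words => /eqP su _ /eqP su' _ /eqP.
  by rewrite eqseq_cat ?su ?su' // => /andP[/eqP -> /eqP ->].
move=> x; rewrite mem_words; apply/eqP/allpairsPdep => [sx|[u [v []]]].
  exists (take m x), (drop m x); rewrite !mem_words size_drop sx addKn cat_take_drop.
  by rewrite size_takel ?sx ?leq_addr ?eqxx.
by rewrite !mem_words => /eqP su /eqP sv ->; rewrite size_cat su sv.
Qed.

End Words.

Section PartitionSums.
Context {R : realType}.
Implicit Types (l : nat -> R[i]) (b : bool) (u v w : seq bool) (n : nat) (t M : R).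

Definition ell l w : R := log_der l (size w) (pull l w 1).

Definition psum l n t : R := \sum_(w <- words n) expR (- (t * ell l w)).

Lemma inV1 : inV (1 : R[i]). Proof. exact: (sg_inV true). Qed.

Lemma ell_ge l w : expanding l -> (size w)%:R <= ell l w.
Proof. by move=> hl; apply/log_der_ge/pull_cyl => //; exact: inV1. Qed.

Lemma ell_ge0 l w : expanding l -> 0 <= ell l w.
Proof. by move=> hl; apply: le_trans (ell_ge w hl); rewrite ler0n. Qed.

Lemma ell_le l w M : expanding l -> (forall n, normc (l n) <= M) ->
  ell l w <= (size w)%:R * (ln M + 1).
Proof. by move=> hl hM; apply/log_der_le/pull_cyl => //; exact: inV1. Qed.

Lemma ell_near l w z : expanding l -> cyl l w z -> `|log_der l (size w) z - ell l w| <= 1.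
Proof. by move=> hl hz; apply: log_orb_distortion => //; exact/pull_cyl/inV1. Qed.

Lemma ell_cons l b w : expanding l ->
  ell l (b :: w) = ln (normc (l 0)) + ln (normc (pull l (b :: w) 1)) + ell (shift l) w.
Proof. by move=> hl; rewrite /ell /size -/(size w) log_derS /= branchK ?expanding_neq0. Qed.

Lemma ell_cat_compare l u w v M : expanding l -> (forall n, normc (l n) <= M) ->
  size u = size w -> ell l (w ++ v) <= ell l (u ++ v) + (size w)%:R * (ln M + 1).
Proof.
elim: u w l => [|b u ih] [|c w] l hl hM //= => [_|[/(ih _ (shift l)) h]].
  by rewrite mul0r addr0.
rewrite !ell_cons // -natr1 mulrDl.
have {h} := h (expanding_shift hl) (fun n => hM n.+1).
have [/= hu _] := pull_cyl (b :: u ++ v) hl inV1.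
have [/= hw _] := pull_cyl (c :: w ++ v) hl inV1.
have := log_step_ge1 (hl 0%N) hu.
have h0 : ln (normc (l 0%N)) <= ln M.
  have h40 := hl 0%N; have hM0 := hM 0%N.
  by rewrite ler_ln ?posrE //; lra.
have : ln (normc (branch (l 0%N) c (pull (shift l) (w ++ v) 1))) <= 1.
  have /andP[h1 h2] := inB_norm hw.
  apply: (@le_trans _ _ (ln (1 + 1))); last by apply: le_ln1Dx; lra.
  by rewrite ler_ln ?posrE //; lra.
by rewrite /= mul1r; lra.
Qed.

(** Both sample points are pulled back from the same point 1, so the end-point term of
    [log_orb_compare] vanishes. *)
Lemma ell_perturb l l' w : expanding l -> expanding l' ->
  `|(ell l' w - ell l w) - (log_par l' (size w) - log_par l (size w))|
  <= par_dist l l' (size w) / 10.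
Proof.
move=> hl hl'.
have := log_orb_compare hl hl' (pull_cyl w hl inV1) (pull_cyl w hl' inV1).
rewrite !orb_pull // subrr normc0 add0r => h.
have -> : ell l' w - ell l w - (log_par l' (size w) - log_par l (size w)) =
  - (log_orb l (size w) (pull l w 1) - log_orb l' (size w) (pull l' w 1)).
  by rewrite /ell /log_der; ring.
rewrite normrN; have := normc_ge0 (pull l w 1 - pull l' w 1); lra.
Qed.

Lemma psum_le l l' n t t' (c : R) :
  (forall w, size w = n -> t * ell l w + c <= t' * ell l' w) ->
  psum l' n t' <= expR (- c) * psum l n t.
Proof.
move=> h; rewrite /psum mulr_sumr !big_seq; apply: ler_sum => w; rewrite mem_words => /eqP sw.
by rewrite -expRD ler_expR; have := h w sw; lra.
Qed.

Lemma sum_words_const n (c : R) : \sum_(w <- words n) c = 2 ^+ n * c.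
Proof.
by rewrite big_const_seq count_predT size_words iter_addr_0 -natrX (mulr_natl _ (2 ^ n)%N).
Qed.

(** By [ell_cat_compare], exchanging prefixes of length [m] changes each term by a bounded factor.
    Hence every cylinder carries a fixed fraction of the partition sum, and unboundedness is
    inherited by each cylinder. *)
Lemma psum_subword l m n w t M : expanding l -> (forall n, normc (l n) <= M) -> 0 <= t ->
  size w = m ->
  psum l (m + n) t <=
    2 ^+ m * expR (t * (m%:R * (ln M + 1))) * \sum_(v <- words n) expR (- (t * ell l (w ++ v))).
Proof.
move=> hl hM t0 sw; rewrite /psum (perm_big _ (words_add m n)) big_allpairs_dep /=.
apply: (@le_trans _ _ (\sum_(u <- words m) (expR (t * (m%:R * (ln M + 1))) *
    \sum_(v <- words n) expR (- (t * ell l (w ++ v)))))).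
  rewrite big_seq [leRHS]big_seq; apply: ler_sum => u; rewrite mem_words => /eqP su.
  rewrite mulr_sumr; apply: ler_sum => v _.
  rewrite -expRD ler_expR -mulrN -[- (t * _)]mulrN -mulrDr ler_wpM2l //.
  have := @ell_cat_compare l u w v M hl hM; rewrite su sw => /(_ erefl); lra.
by rewrite sum_words_const mulrA.
Qed.

End PartitionSums.

(** * Dimension bounds *)

Section HausdorffUpperBound.
Context {R : realType}.
Implicit Types (l : nat -> R[i]) (A : set (sphere R)) (t d : R).

Lemma diam_ge0 A : (0 <= diam A)%E.
Proof. by rewrite /diam le_max lexx. Qed.

Lemma diam_le A (r : R) : 0 <= r -> (forall p q, A p -> A q -> sph_dist p q <= r) ->
  (diam A <= r%:E)%E.
Proof.
move=> r0 h; rewrite /diam ge_max lee_fin r0 /=.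
by apply: ge_ereal_sup => _ [[p q] [/= Ap Aq] <-]; rewrite lee_fin; exact: h.
Qed.

Lemma diam_set0 : diam (set0 : set (sphere R)) = 0%E.
Proof. by apply/eqP; rewrite eq_le diam_ge0 andbT; exact: diam_le. Qed.

Lemma hausdorff_content_ge0 t d A : (0 <= hausdorff_content t d A)%E.
Proof.
apply: le_ereal_inf_tmp => _ [U _ <-]; apply: nneseries_ge0 => n _ _; exact: poweR_ge0.
Qed.

(** The finite cover is continued by empty sets, which contribute 0 because [diam set0 = 0] and
    [0 < t]. *)
Lemma hausdorff_content_finite_cover (I : Type) (s : seq I) (B : I -> set (sphere R)) A t d
    (r : I -> R) : 0 < t -> 0 <= d ->
  (forall i, 0 <= r i) -> (forall i p q, B i p -> B i q -> sph_dist p q <= r i) ->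
  all (fun i => r i <= d) s -> (forall p, A p -> exists2 k, (k < size s)%N &
    forall i0, B (nth i0 s k) p) ->
  (hausdorff_content t d A <= (\sum_(i <- s) r i `^ t)%:E)%E.
Proof.
move=> t0 d0 r0 hB rd cov.
case: s rd cov => [|i0 s'] rd cov.
  apply: ge_ereal_inf; exists 0%E; last by rewrite big_nil.
  exists (fun=> set0); first split=> [i|p /cov[] //]; first by rewrite diam_set0 lee_fin.
  by rewrite eseries0 // => i _ _; rewrite diam_set0 poweR0r ?gt_eqF.
set s := i0 :: s' in rd cov *.
pose U k : set (sphere R) := if (k < size s)%N then B (nth i0 s k) else set0.
have Ur k : (k < size s)%N -> (diam (U k) <= (r (nth i0 s k))%:E)%E.
  by move=> ks; rewrite /U ks; exact: (diam_le (r0 _) (@hB _)).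
apply: ge_ereal_inf; exists (\sum_(0 <= k <oo) poweR (diam (U k)) t)%E.
  exists U => //; split=> [k|p /cov[k ks Bk]]; last by exists k; rewrite // /U ks.
  have [ks|ks] := ltnP k (size s); last by rewrite /U ltnNge ks diam_set0 lee_fin.
  by apply: (le_trans (Ur k ks)); rewrite lee_fin; exact: (all_nthP i0 rd).
apply: lime_le; first by apply: is_cvg_nneseries => n _ _; exact: poweR_ge0.
exists (size s) => // n /= sn.
have tail : (\sum_(size s <= k < n) poweR (diam (U k)) t = 0)%E.
  rewrite big_nat big1 // => k /andP[sk _].
  by rewrite /U ltnNge sk /= diam_set0 poweR0r ?gt_eqF.
rewrite (big_cat_nat (n := size s)) //= -/(size s) tail adde0.
rewrite (big_nth i0) -sumEFin big_nat [leRHS]big_nat; apply: lee_sum => k /andP[_ ks].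
by rewrite -poweR_EFin gt0_ler_poweR ?(ltW t0) ?in_itv /= ?leey ?lee_fin ?diam_ge0 ?Ur ?r0.
Qed.

Lemma hausdorff_measure_trapped l t : expanding l -> 0 < t ->
  (forall e N, 0 < e -> exists2 n, (N <= n)%N & psum l n t <= e) ->
  hausdorff_measure t (julia_set l) = 0%E.
Proof.
move=> hl t0 hpsum; apply/eqP; rewrite eq_le; apply/andP; split; last first.
  by apply: le_ereal_sup_tmp; exists (hausdorff_content t 1 (julia_set l));
    [exists 1 => //=|exact: hausdorff_content_ge0].
apply: ge_ereal_sup => _ [d /= d0 <-]; apply/lee_addgt0Pr => e e0; rewrite add0e.
(* The 6 comes from [cyl_diam]; the 8 is the Lipschitz constant in [sph_dist_le]. *)
pose c : R := ln 8 + 6; have [N hN] := @expR_small R c d d0.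
have [n Nn hn] := hpsum (e / expR (c * t)) N ltac:(by rewrite divr_gt0 ?expR_gt0).
pose B w : set (sphere R) := [set Some z | z in cyl l w].
pose r w : R := expR (c - ell l w).
apply: (le_trans (@hausdorff_content_finite_cover _ (words n) B _ t d r t0 (ltW d0) _ _ _ _)).
- by move=> w; exact: expR_ge0.
- move=> w _ _ [z hz <-] [z' hz' <-]; apply: (le_trans (sph_dist_le _ _)).
  have := cyl_diam hl hz hz' (pull_cyl w hl inV1); rewrite -/(ell l w) => h.
  rewrite /r /c -addrA expRD lnK ?posrE // ler_wpM2l //.
- apply/allP => w; rewrite mem_words => /eqP sw.
  apply: le_trans (hN _ Nn); rewrite ler_expR lerD2l lerN2 -sw; exact: ell_ge.
- move=> p; rewrite julia_setE // => -[z hz <-].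
  pose w := mkseq (itinerary l z) n.
  have ww : w \in words n by rewrite mem_words size_mkseq.
  exists (index w (words n)); first by rewrite index_mem.
  by move=> w0; rewrite nth_index //; exists z => //; exact: trapped_cyl.
rewrite lee_fin (eq_bigr (fun w => expR (c * t) * expR (- (t * ell l w)))); last first.
  by move=> w _; rewrite /r -expRM -expRD; congr expR; ring.
by rewrite -mulr_sumr mulrC -ler_pdivlMr ?expR_gt0.
Qed.

Lemma hausdorff_dim_le l t : expanding l -> 0 < t ->
  (forall e N, 0 < e -> exists2 n, (N <= n)%N & psum l n t <= e) ->
  (hausdorff_dim (julia_set l) <= t%:E)%E.
Proof.
move=> hl t0 h; apply: ereal_inf_lbound; exists t => //; split=> //.
exact: hausdorff_measure_trapped.
Qed.

End HausdorffUpperBound.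

Section PackingLowerBound.
Context {R : realType}.
Implicit Types (l : nat -> R[i]) (U : set (sphere R)) (t d : R) (u v w : seq bool).

Lemma packing_content_ge0 t d U : (0 <= packing_content t d U)%E.
Proof.
apply: ereal_sup_ubound; exists set0, (fun=> None), (fun=> 0).
by rewrite esum_set0; split=> //; split=> // i j [].
Qed.

Lemma packing_premeasure_ge0 t U : (0 <= packing_premeasure t U)%E.
Proof. by apply: le_ereal_inf_tmp => _ [d _ <-]; exact: packing_content_ge0. Qed.

Lemma packing_content_ge (I : eqType) (s : seq I) (c : I -> sphere R) (r : I -> R) U t d :
  uniq s -> {in s, forall i, U (c i) /\ 0 < r i <= d} ->
  {in s &, forall i j, i != j -> r i + r j < sph_dist (c i) (c j)} ->
  ((\sum_(i <- s) (2 * r i) `^ t)%:E <= packing_content t d U)%E.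
Proof.
case: s => [|i0 s'] us hs sep; first by rewrite big_nil packing_content_ge0.
set s := i0 :: s' in us hs sep *.
apply: ereal_sup_ubound; exists `I_(size s), (fun k => c (nth i0 s k)), (fun k => r (nth i0 s k)).
split; last first.
  rewrite esum_fset; [|exact: finite_II|by move=> k _; rewrite lee_fin powR_ge0].
  by rewrite -fsbig_ord (big_nth i0) -sumEFin big_mkord.
split=> [k /= ks|k k' /= ks k's [q [/= h1 h2]]]; first exact/hs/mem_nth.
apply/eqP; rewrite -(nth_uniq i0 (s := s) ks k's us); apply: contraT => kk'.
have := sep _ _ (mem_nth (s := s) i0 ks) (mem_nth (s := s) i0 k's) kk'.
have := sph_dist_triangle q (c (nth i0 s k)) (c (nth i0 s k')).
move: h1 h2; rewrite /mdist_cball /= [mdist (c (nth i0 s k')) q]sph_distC.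
rewrite -[mdist (c (nth i0 s k)) q]/(sph_dist _ _); lra.
Qed.

Definition unbounded_psum l t := forall (C : R) (N : nat), exists2 n, (N <= n)%N & C <= psum l n t.

(** A set meeting every subcylinder of [w] contains separated centres, one per subcylinder, and the
    resulting packing sums are comparable to partition sums. *)
Lemma packing_premeasure_dense l w U t M : expanding l -> (forall n, normc (l n) <= M) ->
  0 < t -> unbounded_psum l t ->
  (forall v, exists z, U (Some z) /\ cyl l (w ++ v) z) ->
  packing_premeasure t U = +oo%E.
Proof.
move=> hl hM t0 hpsum /choice[z hz]; apply: eq_infty => C.
apply: le_ereal_inf_tmp => _ [d /= d0 <-].
(* Separation and distortion each cost 1 in the exponent. In 24, the factor 6 passes to the
   spherical metric and the remaining 4 makes the balls disjoint. *)
pose c : R := - (2 + ln 24); pose m := size w.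
pose r v : R := expR (c - ell l (w ++ v)).
have [N hN] := @expR_small R c d d0.
pose K : R := 2 ^+ m * expR (t * (m%:R * (ln M + 1))).
have K0 : 0 < K by rewrite mulr_gt0 ?exprn_gt0 ?expR_gt0.
pose K' : R := 2 `^ t * expR (c * t).
have K'0 : 0 < K' by rewrite mulr_gt0 ?powR_gt0 ?expR_gt0.
have [n' Nn' hn'] := hpsum (C / K' * K) (m + N)%N.
have [n en] : exists n, n' = (m + n)%N.
  by exists (n' - m)%N; rewrite subnKC // (leq_trans _ Nn') ?leq_addr.
have Nn : (N <= n)%N by move: Nn'; rewrite en leq_add2l.
have rE v : 24 * r v = expR (-2 - ell l (w ++ v)).
  rewrite -[24 in LHS]lnK ?posrE // -expRD; congr expR; rewrite /c; ring.
have sep v v' : size v = size v' -> v <> v' -> 24 * r v <= normc (z v - z v').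
  move=> svv' vv'; rewrite rE.
  have sw : size (w ++ v) = size (w ++ v') by rewrite !size_cat svv'.
  have ww : w ++ v <> w ++ v'.
    by move=> /eqP; rewrite eqseq_cat // eqxx /= => /eqP.
  apply: le_trans (cyl_separation hl sw ww (hz v).2 (hz v').2).
  by have := ell_near hl (hz v).2; rewrite ler_expR ler_norml; lra.
apply: (@le_trans _ _ (\sum_(v <- words n) (2 * r v) `^ t)%:E); last first.
  apply: (packing_content_ge (c := fun v => Some (z v))); first exact: uniq_words.
    move=> v; rewrite mem_words => /eqP sv; split; first exact: (hz v).1.
    rewrite expR_gt0 /=; apply: le_trans (hN _ Nn).
    rewrite ler_expR lerD2l lerN2; apply: le_trans (ell_ge _ hl).
    by rewrite ler_nat size_cat sv leq_addl.
  move=> v v'; rewrite !mem_words => /eqP sv /eqP sv' /eqP vv'.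
  have h1 := sep v v' (etrans sv (esym sv')) vv'.
  have h2 := sep v' v (etrans sv' (esym sv)) (nesym vv'); rewrite normcBC in h2.
  have := sph_dist_ge (cyl_inV (hz v).2) (cyl_inV (hz v').2).
  have : 0 < r v by exact: expR_gt0.
  lra.
rewrite lee_fin (eq_bigr (fun v => K' * expR (- (t * ell l (w ++ v))))); last first.
  move=> v _; rewrite powRM ?expR_ge0 // /r -expRM /K' -mulrA -expRD; congr (_ * expR _); ring.
rewrite -mulr_sumr mulrC -ler_pdivrMr // -(ler_pM2r K0); apply: (le_trans hn').
rewrite en mulrC; exact: psum_subword (ltW t0) _.
Qed.

(* Baire's argument on words: a set of finite packing premeasure misses some
   subcylinder of every cylinder. *)
Lemma packing_measure_neq0 l t M : expanding l -> (forall n, normc (l n) <= M) ->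
  0 < t -> unbounded_psum l t -> packing_measure t (julia_set l) <> 0%E.
Proof.
move=> hl hM t0 hpsum h0.
have : (packing_measure t (julia_set l) < 1)%E by rewrite h0 lte01.
move=> /ereal_inf_lt[_ [U cov <-] hU].
(* The sum over the cover is below 1, so no member can be dense in a cylinder in the sense of
   [packing_premeasure_dense]. *)
have hfin i : packing_premeasure t (U i) <> +oo%E.
  move=> hi; move: hU; apply/negP; rewrite -leNgt.
  apply: (@le_trans _ _ (\sum_(0 <= k < i.+1) packing_premeasure t (U k))%E); last first.
    by apply: nneseries_lim_ge => k _ _; exact: packing_premeasure_ge0.
  by rewrite big_nat_recr //= hi addey ?leey // gt_eqF // (lt_le_trans (ltNyr 0)) //
    sume_ge0 // => k _; exact: packing_premeasure_ge0.
have /choice[ext hext] : forall i, exists f : seq bool -> seq bool,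
    forall w z, cyl l (w ++ f w) z -> ~ U i (Some z).
  move=> i; suff /choice[f hf] : forall w, exists v, forall z, cyl l (w ++ v) z -> ~ U i (Some z).
    by exists f.
  move=> w; apply: contrapT => hv; apply: (hfin i).
  apply: (packing_premeasure_dense (w := w) hl hM t0 hpsum).
  move=> v; apply: contrapT => hz; apply: hv; exists v => z cz Uz.
  by apply: hz; exists z.
(* Step [k] extends the word so as to avoid [U k]; the extra letter makes the lengths grow strictly,
   so that the words define an infinite sequence. *)
pose fix pw i := if i is k.+1 then pw k ++ ext k (pw k) ++ [:: true] else [::].
have spw i : (i <= size (pw i))%N.
  by elim: i => //= i ih; rewrite !size_cat /=; lia.
have pwS i k : exists v, pw (i + k)%N = pw i ++ v.
  elim: k => [|k [v ih]]; first by exists [::]; rewrite addn0 cats0.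
  by exists (v ++ ext (i + k)%N (pw (i + k)%N) ++ [:: true]); rewrite addnS /= ih -!catA.
pose s n := nth true (pw n.+1) n.
have pws i : pw i = mkseq s (size (pw i)).
  apply: (@eq_from_nth _ true) => [|k ki]; first by rewrite size_mkseq.
  rewrite nth_mkseq // /s.
  have [v1] := pwS i k.+1; have [v2] := pwS k.+1 i; rewrite addnC => -> e.
  have := congr1 (nth true ^~ k) e; rewrite !nth_cat ki.
  by rewrite (leq_trans (ltnSn k) (spw k.+1)).
have [z hz] := trapped_of_itinerary s hl.
have [i _ Uz] := cov (Some z) (trapped_julia hl (cyl_trapped hz)).
apply: (hext i (pw i) z) Uz.
have := hz (size (pw i.+1)); rewrite -pws /= catA; exact: cyl_cat.
Qed.

Lemma packing_dim_ge l t M : expanding l -> (forall n, normc (l n) <= M) ->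
  unbounded_psum l t -> (t%:E <= packing_dim (julia_set l))%E.
Proof.
move=> hl hM hpsum; apply: le_ereal_inf_tmp => _ [s [s0 hs] <-].
rewrite lee_fin leNgt; apply/negP => st.
apply: (packing_measure_neq0 hl hM s0 _ hs) => C N.
have [n Nn hn] := hpsum C N; exists n => //; apply: (le_trans hn).
apply: ler_sum => w _; rewrite ler_expR lerN2 ler_wpM2r ?ell_ge0 //; exact: ltW.
Qed.

End PackingLowerBound.

(** * Perturbation of the parameters *)

(** Cut points [a k] satisfying [P] are chosen with [a k.+1] larger than [K.+1] times [a k], and [S]
    is the union of the odd blocks. At the end of a block, everything before that block is
    negligible. *)
Lemma alternating_blocks (P : nat -> Prop) (K : nat) :
  (forall N, exists2 n, (N <= n)%N & P n) ->
  exists S : nat -> bool,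
    (forall N, exists n, [/\ (N <= n)%N, P n & (K * (n - \sum_(i < n) S i) <= n)%N]) /\
    (forall N, exists n, [/\ (N <= n)%N, P n & (K * \sum_(i < n) S i <= n)%N]).
Proof.
move=> hP; have /choice[f hf] : forall N, exists n, (N <= n)%N /\ P n.
  by move=> N; have [n ? ?] := hP N; exists n.
pose fix a k := if k is j.+1 then f (K * a j + a j).+1 else f 0%N.
have aP k : P (a k) by case: k => [|k]; exact: (hf _).2.
have aS k : (K * a k + a k < a k.+1)%N by exact: (hf _).1.
have ainc : {homo a : m n / (m < n)%N}.
  apply: homo_ltn => [x y z|k]; first exact: ltn_trans.
  by apply: leq_ltn_trans (aS k); rewrite leq_addl.
have a_ge k : (k <= a k)%N := homo_ltn_ge k ainc.
pose S i := `[< exists k, odd k /\ (a k <= i < a k.+1)%N >].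
have SE k i : (a k <= i < a k.+1)%N -> S i = odd k.
  move=> /andP[h1 h2]; apply/asboolP/idP => [[j [oj /andP[h3 h4]]]|ok].
    have [kj|jk|kj] := ltngtP k j; last by rewrite kj.
      by have := leq_trans h2 (leq_trans (ltnW_homo ainc kj) h3); rewrite ltnn.
    by have := leq_trans h4 (leq_trans (ltnW_homo ainc jk) h1); rewrite ltnn.
  by exists k; rewrite ok h1.
have SA k : exists2 s0, (s0 <= a k)%N &
    (\sum_(i < a k.+1) S i = s0 + (a k.+1 - a k) * odd k)%N.
  exists (\sum_(0 <= i < a k) S i)%N.
    apply: (@leq_trans (\sum_(0 <= i < a k) 1)%N); last by rewrite sum_nat_const_nat subn0 muln1.
    by apply: leq_sum => i _; case: (S i).
  rewrite -(big_mkord xpredT (fun i => S i : nat)).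
  rewrite (big_cat_nat (n := a k)) //=; last exact: ltnW (ainc _ _ (ltnSn k)).
  congr addn; rewrite -sum_nat_const_nat; apply: eq_big_nat => i /SE ->.
  by [].
exists S; split=> N.
  exists (a N.*2.+2); have [s0 hs ->] := SA N.*2.+1.
  rewrite [odd _]/= odd_double muln1; split=> //.
    by apply: leq_trans (a_ge _); rewrite -addnn; lia.
  have := aS N.*2.+1; nia.
exists (a N.*2.+1); have [s0 hs ->] := SA N.*2.
rewrite odd_double muln0 addn0; split=> //.
  by apply: leq_trans (a_ge _); rewrite -addnn; lia.
have := aS N.*2; nia.
Qed.

Section Perturbation.
Context {R : realType}.
Implicit Types (l : nat -> R[i]) (S : nat -> bool) (w : seq bool) (n : nat).

Definition boost (e : R) S l : nat -> R[i] := fun i => if S i then (1 + e)%:C%C * l i else l i.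

Lemma ratio_bounds (e : R) : 0 < e <= 1 ->
  [/\ 0 < e / (1 + e), e / (1 + e) <= ln (1 + e), ln (1 + e) <= e & e / (1 + e) <= e].
Proof.
move=> /andP[e0 e1]; have e2 : 0 < 1 + e by lra.
split; first by rewrite divr_gt0.
- have := @le_ln1Dx _ (- (e / (1 + e))).
  have -> : 1 - e / (1 + e) = (1 + e)^-1 by field; lra.
  rewrite lnV ?posrE // => h; rewrite -lerN2; apply: h.
  by rewrite ltrN2 ltr_pdivrMr // mul1r; lra.
- by apply: le_ln1Dx; lra.
- by rewrite ler_pdivrMr // ler_peMr //; lra.
Qed.

(** Each boosted index adds exactly [ln (1 + e)] to [log_par], while the displacement of the sample
    point costs at most a tenth of [e / (1 + e)]. *)
Lemma boost_ell (e : R) S l w : expanding l -> expanding (boost e S l) -> 0 < e <= 1 ->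
  9 / 10 * (e / (1 + e)) * (\sum_(i < size w) S i)%:R <= ell (boost e S l) w - ell l w
    <= 2 * e * (\sum_(i < size w) S i)%:R.
Proof.
move=> hl hl' he; have [q0 q1 q2 q3] := ratio_bounds he.
have /andP[e0 e1] := he.
have hpar : log_par (boost e S l) (size w) - log_par l (size w)
    = (\sum_(i < size w) S i)%:R * ln (1 + e).
  rewrite /log_par -sumrB natr_sum mulr_suml; apply: eq_bigr => i _.
  rewrite /boost; case: (S i); last by rewrite subrr mul0r.
  rewrite normcM normc_real; last by lra.
  by rewrite lnM ?posrE //; [rewrite addrK mul1r|lra|have := hl i; lra].
have hdist : par_dist l (boost e S l) (size w)
    = (\sum_(i < size w) S i)%:R * (e / (1 + e)).
  rewrite /par_dist natr_sum mulr_suml; apply: eq_bigr => i _.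
  rewrite /boost; have li := expanding_neq0 i hl.
  case: (S i); last by rewrite divff // subrr normc0 mul0r.
  have c0 : ((1 + e)%:C)%C != 0 :> R[i] by rewrite -normc_gt0 normc_real; lra.
  have -> : 1 - l i / ((1 + e)%:C%C * l i) = (e%:C)%C / ((1 + e)%:C)%C.
    by rewrite rmorphD /= in c0 *; field; rewrite c0.
  by rewrite normc_div !normc_real ?mul1r //; lra.
have := ell_perturb w hl hl'; rewrite hpar hdist.
move: (\sum_(i < size w) S i)%:R (ler0n R (\sum_(i < size w) S i)) => c c0.
have h1 := ler_wpM2l c0 q1; have h2 := ler_wpM2l c0 q2; have h3 := ler_wpM2l c0 q3.
by rewrite ler_norml => /andP[h4 h5]; apply/andP; split; lra.
Qed.

Lemma ell_close l l' w (d : R) : expanding l -> expanding l' ->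
  (forall i, normc (l i - l' i) <= d) -> `|ell l' w - ell l w| <= (size w)%:R * d.
Proof.
move=> hl hl' hd; have d0 : 0 <= d := le_trans (normc_ge0 _) (hd 0%N).
have hpar : `|log_par l' (size w) - log_par l (size w)| <= (size w)%:R * (d / 40).
  rewrite /log_par -sumrB; apply: (le_trans (ler_norm_sum _ _ _)).
  rewrite -[in leRHS](card_ord (size w)) -sum1_card natr_sum mulr_suml; apply: ler_sum => i _.
  apply: (le_trans (@ln_lipschitz _ 40 _ _ _ _ _)) => //; [exact/ltW/hl'|exact/ltW/hl|].
  rewrite mul1r ler_wpM2r //; apply: le_trans (hd i).
  have := le_normcB (l' i) (l i); have := le_normcB (l i) (l' i).
  by rewrite (normcBC (l' i)) ler_norml; lra.
have hdist : par_dist l l' (size w) <= (size w)%:R * (d / 40).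
  rewrite /par_dist -[in leRHS](card_ord (size w)) -sum1_card natr_sum mulr_suml.
  apply: ler_sum => i _; have l0 := expanding_neq0 i hl'; rewrite mul1r.
  have -> : 1 - l i / l' i = (l' i - l i) / l' i by field.
  rewrite normc_div normcBC ler_pM ?invr_ge0 ?normc_ge0 // lef_pV2 ?posrE //; first exact/ltW/hl'.
  by have := hl' i; lra.
have hell := ell_perturb w hl hl'.
have -> : ell l' w - ell l w = ell l' w - ell l w - (log_par l' (size w) - log_par l (size w))
  + (log_par l' (size w) - log_par l (size w)) by ring.
apply: (le_trans (ler_normD _ _)); move: hell.
have : 0 <= (size w)%:R * d by rewrite mulr_ge0.
lra.
Qed.

End Perturbation.

(** * The critical exponent of the partition sums *)

Section CriticalExponent.
Context {R : realType}.
Implicit Types (l : nat -> R[i]) (n : nat) (t : R).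

Lemma psum_decr l n t t' : expanding l -> t <= t' -> psum l n t' <= psum l n t.
Proof.
move=> hl tt'; apply: ler_sum => w _.
by rewrite ler_expR lerN2 ler_wpM2r // ell_ge0.
Qed.

Lemma psum1_le1 l n : expanding l -> psum l n 1 <= 1.
Proof.
move=> hl; apply: (@le_trans _ _ (\sum_(w <- words n) expR (- n%:R))).
  rewrite /psum !big_seq; apply: ler_sum => w; rewrite mem_words => /eqP sw.
  by rewrite ler_expR lerN2 mul1r -sw ell_ge.
rewrite sum_words_const expRN ler_pdivrMr ?expR_gt0 // mul1r.
rewrite -[n%:R]mulr1 expRM_natl lerXn2r ?nnegrE ?expR_ge0 //.
by apply: le_trans (expR_ge1Dx 1); lra.
Qed.

(** There are [2 ^+ n] terms, each at least [expR (- (t * (n%:R * (ln M + 1))))]. This keeps the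
    critical exponent away from 0. *)
Lemma psum_le1_exponent l n t M : expanding l -> (forall n, normc (l n) <= M) ->
  (0 < n)%N -> 0 <= t -> psum l n t <= 1 -> ln 2 / (ln M + 1) <= t.
Proof.
move=> hl hM n0 t0 h.
have B0 : 0 < ln M + 1.
  have : 0 <= ln M by apply: ln_ge0; have := hl 0%N; have := hM 0%N; lra.
  lra.
have : 2 ^+ n * expR (- (t * (n%:R * (ln M + 1)))) <= 1.
  apply: le_trans h; rewrite -sum_words_const /psum !big_seq; apply: ler_sum => w.
  rewrite mem_words => /eqP sw; rewrite ler_expR lerN2 ler_wpM2l // -sw; exact: ell_le.
rewrite expRN ler_pdivrMr ?expR_gt0 // mul1r -[2 in leLHS]lnK ?posrE //.
rewrite -expRM_natl ler_expR ler_pdivrMr // [t * _]mulrCA ler_pM2l ?ltr0n //.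
Qed.

(* h is the infimum of the t > 0 such that psum l n t <= 1 for infinitely many n. *)
Lemma critical_exponent l M : expanding l -> (forall n, normc (l n) <= M) ->
  exists2 h, 0 < h & forall a, 0 < a < h ->
    (forall N, exists2 n, (N <= n)%N & psum l n (h + a) <= 1) /\
    exists N, forall n, (N <= n)%N -> 1 <= psum l n (h - a).
Proof.
move=> hl hM; pose T := [set t | 0 < t /\ forall N, exists2 n, (N <= n)%N & psum l n t <= 1].
have M40 : 40 < M := lt_le_trans (hl 0%N) (hM 0%N).
have T0 : T !=set0 by exists 1; split=> // N; exists N; rewrite ?psum1_le1.
have lb : lbound T (ln 2 / (ln M + 1)).
  move=> t [t0 /(_ 1%N)[n n0 hn]]; exact: psum_le1_exponent hl hM n0 (ltW t0) hn.
have hT : has_inf T by split=> //; exists (ln 2 / (ln M + 1)).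
exists (inf T).
  apply: lt_le_trans (lb_le_inf T0 lb); rewrite divr_gt0 ?ln_gt0 ?ltr1n //.
  have : 0 <= ln M by apply: ln_ge0; lra.
  lra.
move=> a /andP[a0 ah]; split=> [N|].
  have [t [t0 ht] tlt] := inf_adherent a0 hT.
  have [n Nn hn] := ht N; exists n => //; apply: le_trans hn.
  exact: psum_decr hl (ltW tlt).
have : ~ T (inf T - a).
  by move=> /(ge_inf hT.2); rewrite lerBrDr; lra.
move=> /not_andP[|/existsNP[N hN]]; first by rewrite subr_gt0.
exists N => n Nn; rewrite leNgt; apply/negP => hlt; apply: hN; exists n => //.
exact: ltW.
Qed.

End CriticalExponent.

(** * The dimension gap near a boosted sequence *)

Section DimensionGap.
Context {R : realType}.
Implicit Types (l : nat -> R[i]) (n : nat) (t : R).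

Lemma expR_natmul_large (a C : R) : 0 < a -> exists N, forall n, (N <= n)%N -> C <= expR (n%:R * a).
Proof.
move=> a0; have [N hN] := ltr_archi_nat (C / a); exists N => n Nn.
apply: le_trans (expR_ge1Dx _); have : C <= N%:R * a by rewrite -ler_pdivrMr // ltW.
have : N%:R * a <= n%:R * a by rewrite ler_pM2r // ler_nat.
lra.
Qed.

Lemma dimension_gap l (M e : R) : expanding l -> (forall n, normc (l n) <= M) -> 0 < e <= 1 ->
  exists S, exists2 d, 0 < d & forall l', expanding (boost e S l) -> expanding l' ->
    (forall i, normc (boost e S l i - l' i) <= d) ->
    (hausdorff_dim (julia_set l') < packing_dim (julia_set l'))%E.
Proof.
move=> hl hM he; have [h h0 hcrit] := critical_exponent hl hM.
have [q0 _ _ qe] := ratio_bounds he; have /andP[e0 e1] := he.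
set q := e / (1 + e) in q0 qe.
have M40 : 40 < M := lt_le_trans (hl 0%N) (hM 0%N).
pose B := ln (3 * M) + 1.
have B0 : 0 < B by have : 0 <= ln (3 * M) by [apply: ln_ge0; lra]; rewrite /B; lra.
(* Lowering the exponent from [h + a] to [h - 3 * a] costs at most [4 * a * B] per letter, half of
   the gain [h * (9 / 10 * q) / 2] obtained at the ends of the boosted blocks. *)
pose a := Num.min (h / 8) (h * (9 / 10 * q) / (16 * B)).
have p0 : 0 < 9 / 10 * q by rewrite mulr_gt0.
have hp0 : 0 < h * (9 / 10 * q) by rewrite mulr_gt0.
have a0 : 0 < a by rewrite lt_min divr_gt0 //= divr_gt0 // mulr_gt0.
have a8 : a <= h / 8 by rewrite ge_min lexx.
have aB : 4 * a * B <= h * (9 / 10 * q) / 4.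
  have : a <= h * (9 / 10 * q) / (16 * B) by rewrite ge_min lexx orbT.
  rewrite ler_pdivlMr ?mulr_gt0 //; lra.
have [h1 h2] := hcrit a ltac:(lra).
(* [4 <= K] makes at least 3/4 of the indices boosted at the end of a boosted block;
   [8 * e * h <= K%:R * a] makes the boost cost at most [a / 4] per letter at the end of an
   unboosted one. *)
have [K hK] := ltr_archi_nat (8 * e * h / a + 4).
have [S [Sodd Seven]] := alternating_blocks K h1.
(* The three bounds keep [l'] below [3 * M], preserve the gain at boosted ends, and add at most
   another [a / 4] per letter at unboosted ends. *)
pose d := Num.min 1 (Num.min (9 / 10 * q / 4) (a / (4 * h))).
have d0 : 0 < d by rewrite !lt_min ltr01 divr_gt0 //= divr_gt0 // mulr_gt0.
have d1 : d <= 1 by rewrite ge_min lexx.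
have dq : d <= 9 / 10 * q / 4 by rewrite !ge_min lexx orbT.
have da : d * h <= a / 4.
  have : d <= a / (4 * h) by rewrite !ge_min lexx !orbT.
  rewrite ler_pdivlMr ?mulr_gt0 //; lra.
exists S, d => // l' hb hl' hd.
have K4 : 4 <= K%:R :> R.
  by apply: ltW; apply: le_lt_trans hK; rewrite lerDr divr_ge0 // ?mulr_ge0 // ltW.
have Kh : 8 * e * h <= K%:R * a.
  by rewrite -ler_pdivrMr //; lra.
have hM' i : normc (l' i) <= 3 * M.
  have := hd i; have := le_normcB (l' i) (boost e S l i); rewrite normcBC.
  have : normc (boost e S l i) <= 2 * M.
    rewrite /boost; have := hM i; case: (S i); last by lra.
    by rewrite normcM normc_real; [move=> ?; rewrite ler_pM ?normc_ge0 //; lra|lra].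
  lra.
have hell w : 9 / 10 * q * (\sum_(i < size w) S i)%:R - (size w)%:R * d <= ell l' w - ell l w
    <= 2 * e * (\sum_(i < size w) S i)%:R + (size w)%:R * d.
  have := boost_ell w hl hb he; have := ell_close w hb hl' hd; rewrite -/q ler_norml.
  by move=> /andP[u1 u2] /andP[u3 u4]; apply/andP; split; lra.
(* At the ends of boosted blocks, [psum l n (h + a) <= 1] turns into an exponentially small sum for
   [l'] at the exponent [h - 3 * a]. *)
have hle : (hausdorff_dim (julia_set l') <= (h - 3 * a)%:E)%E.
  apply: hausdorff_dim_le => //; first by lra.
  pose b := h * (9 / 10 * q) / 4.
  have b0 : 0 < b by rewrite divr_gt0.
  move=> x N x0; have [N1 hN1] := expR_natmul_large x^-1 b0.
  have [n [Nn hn Sn]] := Sodd (maxn N N1).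
  exists n; first by apply: leq_trans Nn; rewrite leq_maxl.
  have {hN1} := hN1 n (leq_trans (leq_maxr _ _) Nn); rewrite invf_ple ?posrE ?expR_gt0 //.
  apply: le_trans; rewrite -expRN.
  apply: (@le_trans _ _ (expR (- (n%:R * b)) * psum l n (h + a))); last first.
    by rewrite ler_piMr ?expR_ge0.
  apply: psum_le => w sw; have /andP[hw _] := hell w; rewrite sw in hw.
  have hB := ell_le w hl' hM'; rewrite sw -/B in hB.
  have hc : 3 / 4 * n%:R <= (\sum_(i < n) S i)%:R :> R.
    have : K%:R * (n%:R - (\sum_(i < n) S i)%:R) <= n%:R :> R.
      rewrite -natrB; first by rewrite -natrM ler_nat.
      rewrite -[leqRHS]card_ord -sum1_card; apply: leq_sum => i _; by case: (S i).
    have := ler0n R n; nra.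
  move: (ell l' w) (ell l w) ((\sum_(i < n) S i)%:R) hw hB hc => E' E c hw hB hc.
  have n0 := ler0n R n.
  have u1 : 9 / 10 * q / 2 * n%:R <= E' - E.
    have v1 : 9 / 10 * q * (3 / 4 * n%:R) <= 9 / 10 * q * c.
      by rewrite ler_wpM2l // mulr_ge0 // ltW.
    have : n%:R * d <= n%:R * (9 / 10 * q / 4) by rewrite ler_wpM2l.
    lra.
  have u2 : h * (9 / 10 * q / 2 * n%:R) <= (h + a) * (E' - E).
    apply: ler_pM => //; [exact: ltW| |lra].
    by rewrite mulr_ge0 // divr_ge0 // ltW.
  have u3 : 4 * a * E' <= 4 * a * (n%:R * B) by rewrite ler_wpM2l // mulr_ge0 // ltW.
  have : n%:R * (4 * a * B) <= n%:R * b by rewrite ler_wpM2l.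
  by rewrite /b in b0 *; lra.
(* At the ends of unboosted blocks, passing from [h - a] to [h - 2 * a] gains [a] per letter, as
   [ell l w] is at least the length; boost and perturbation use up at most half of it. *)
have hge : ((h - 2 * a)%:E <= packing_dim (julia_set l'))%E.
  apply: (packing_dim_ge hl' hM') => C N.
  have [N1 hN1] := expR_natmul_large C (divr_gt0 a0 (ltr0Sn R 1)).
  have [N2 hN2] := h2.
  have [n [Nn _ Sn]] := Seven (maxn N (maxn N1 N2)).
  move: Nn; rewrite !geq_max => /and3P[Nn N1n N2n].
  exists n => //; apply: (le_trans (hN1 n N1n)).
  rewrite -[leLHS]mulr1; apply: (le_trans (ler_wpM2l (expR_ge0 _) (hN2 n N2n))).
  rewrite -ler_pdivlMl ?expR_gt0 // -expRN; apply: psum_le => w sw.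
  have /andP[_ hw] := hell w; rewrite sw in hw.
  have hn := ell_ge w hl; rewrite sw in hn.
  have hc : K%:R * (\sum_(i < n) S i)%:R <= n%:R :> R by rewrite -natrM ler_nat.
  move: (ell l' w) (ell l w) ((\sum_(i < n) S i)%:R) (ler0n R (\sum_(i < n) S i)) hw hn hc.
  move=> E' E c c0 hw hn hc; have n0 := ler0n R n.
  have u1 : (h - 2 * a) * (E' - E) <= h * (2 * e * c + n%:R * d).
    apply: (@le_trans _ _ ((h - 2 * a) * (2 * e * c + n%:R * d))).
      by rewrite ler_wpM2l //; lra.
    rewrite ler_wpM2r //; last by lra.
    by rewrite addr_ge0 ?mulr_ge0 // ltW.
  have u2 : h * (2 * e * c) <= n%:R * a / 4.
    have v1 : 8 * e * h * c <= K%:R * a * c by rewrite ler_wpM2r.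
    have : a * (K%:R * c) <= a * n%:R by rewrite ler_wpM2l // ltW.
    lra.
  have u3 : n%:R * (d * h) <= n%:R * (a / 4) by rewrite ler_wpM2l.
  have u4 : a * n%:R <= a * E by rewrite ler_wpM2l // ltW.
  lra.
apply: (le_lt_trans hle); apply: lt_le_trans hge.
by rewrite lte_fin; lra.
Qed.

End DimensionGap.

(** * Sup-norm neighbourhoods and density *)

Section OpenDense.
Context {R : realType}.
Implicit Types (l : linf R).

Lemma nbhs_linfP l (A : set (linf R)) :
  nbhs l A <-> exists2 r, 0 < r & forall l', linf_dist l l' < r -> A l'.
Proof.
split; first by move=> /nbhs_ballP[r /= r0 h]; exists r.
by move=> [r r0 h]; apply/nbhs_ballP; exists r => //= l'; rewrite ballEmdist => /h.
Qed.

Lemma linf_boost_bounded (e : R) S l : 0 < e <= 1 ->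
  exists M, forall n, normc (boost e S l n) <= M.
Proof.
move=> he; have [M hM] := linf_bounded l; exists (2 * M) => n.
rewrite /boost; have hn := hM n; have h0 := normc_ge0 (l n); case: (S n); last by lra.
by rewrite normcM normc_real; [rewrite ler_pM ?normc_ge0 //; lra|lra].
Qed.

Lemma boost_dist (e M : R) S l i : 0 < e -> (forall n, normc (l n) <= M) ->
  normc (l i - boost e S l i) <= e * M.
Proof.
move=> e0 hM; have M0 : 0 <= M := le_trans (normc_ge0 _) (hM 0%N).
rewrite /boost; case: (S i); last by rewrite subrr normc0 mulr_ge0 // ltW.
have -> : l i - (1 + e)%:C%C * l i = - ((e%:C)%C * l i).
  by rewrite rmorphD /=; ring.
by rewrite normcN normcM normc_real ?(ltW e0) // ler_pM2l.
Qed.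

End OpenDense.

Local Open Scope ereal_scope.

Theorem theorem1p5 (R : realType) :
  exists Omega : set (linf R),
    [/\ open Omega,
        Omega `<=` Lambda,
        Lambda `<=` closure Omega &
        forall l : linf R, Omega l ->
          hausdorff_dim (julia_set l) < packing_dim (julia_set l)].
Proof.
(* Taking the interior of the set of good parameters makes openness automatic, so only density
   remains to be shown. *)
pose A : set (linf R) := [set l : linf R | Lambda l /\
  hausdorff_dim (julia_set l) < packing_dim (julia_set l)].
have AE : A° `<=` A by exact: interior_subset.
exists A°; split; [exact: open_interior|by move=> l /AE[]| |by move=> l /AE[]].
move=> l Ll B /nbhs_linfP[r1 r10 hB].
have /nbhs_linfP[r2 r20 hL] := Ll.
have hl : expanding l by apply: (hL l); rewrite linf_distxx.
have [M hM] := linf_bounded l.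
have M40 : (40 < M)%R := lt_le_trans (hl 0%N) (hM 0%N).
pose r := Num.min r1 r2; have r0 : (0 < r)%R by rewrite lt_min r10.
have rr1 : (r <= r1)%R by rewrite ge_min lexx.
have rr2 : (r <= r2)%R by rewrite ge_min lexx orbT.
(* With this [e], boosting moves [l] by at most [r / 4], hence inside both the given neighbourhood
   and [Lambda]. *)
pose e := Num.min 1%R (r / (4 * M))%R.
have eM : (e * M <= r / 4)%R.
  have : (e <= r / (4 * M))%R by rewrite ge_min lexx orbT.
  by rewrite ler_pdivlMr ?mulr_gt0 //; lra.
have he : (0 < e <= 1)%R.
  by rewrite ge_min lexx lt_min ltr01 divr_gt0 // mulr_gt0 //; lra.
have [S [d d0 hgap]] := dimension_gap hl hM he.
pose b := Linf (linf_boost_bounded S l he).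
have db : (linf_dist l b <= r / 4)%R.
  apply: linf_dist_le => n; apply: le_trans eM; apply: boost_dist => //.
  by have /andP[] := he.
have ball_exp l' : (linf_dist l l' < r2)%R -> expanding l' by move=> /hL.
have hb : expanding b.
  by apply: ball_exp; apply: le_lt_trans db _; lra.
exists b; split; last first.
  by apply: hB; apply: le_lt_trans db _; lra.
(* This ball around [b] lies within [r / 2] of [l], so in [Lambda], and within the radius [d] on
   which [dimension_gap] applies. *)
apply/nbhs_linfP; exists (Num.min d (r / 4))%R; first by rewrite lt_min d0 divr_gt0.
move=> l'; rewrite lt_min => /andP[l'd l'r].
have dl' : (linf_dist l l' < r2)%R.
  apply: le_lt_trans (linf_dist_triangle b l l') _; lra.
split.
  apply/nbhs_linfP; exists (r2 - linf_dist l l')%R; first by rewrite subr_gt0.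
  move=> l'' h; apply: ball_exp; apply: le_lt_trans (linf_dist_triangle l' l l'') _; lra.
apply: hgap => //; first exact: ball_exp.
by move=> i; apply: le_trans (ltW l'd); exact: (linf_dist_ub b l' i).
Qed.
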